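(* (Optimal $1\to1$ learning.) Let $d\ge 2$. The minimum of $D[\mathbf R]$ over all learning networks $\mathbf R=\{R_i\}_{i=1}^d$ with $N=1$ use of the unknown measurement is $$D_{opt}=\frac{d}{d^2-1}\left(1-\frac{d+1}{d^2}\right)^2 .$$ It is attained by the learning network $$R_i=|i\rangle\langle i|_{1}\otimes\frac1d P^p_{20}+(I-|i\rangle\langle i|)_{1}\otimes\frac{1}{d(d-1)}P^q_{20},\qquad i=1,\dots,d,$$ where $P^p=\frac1d|\omega\rangle\langle\omega|$, $|\omega\rangle=\sum_{n=1}^d|n\rangle|n\rangle\in\mathcal H_2\otimes\mathcal H_0$ and $P^q=I-P^p$. Its replicated POVM is, for every $U\in SU(d)$ and every $i$, $$G^{(U)}_i=\frac{1}{d(d-1)}\,U|i\rangle\langle i|U^\dagger+\frac{d^2-d-1}{d^2(d-1)}\,I ,$$ and in particular $\langle i|G^{(I)}_i|i\rangle=\frac{d+1}{d^2}$ for every $i$.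
   Context: Fix an orthonormal basis $\{|i\rangle\}_{i=1}^d$ of $\mathbb C^d$; transposition is with respect to it. Let $\mathcal H_0,\mathcal H_1,\mathcal H_2$ be copies of $\mathbb C^d$; subscripts on operators indicate the spaces on which they act. For $U\in SU(d)$ the unknown von Neumann measurement is $\mathbf E^{(U)}=\{E^{(U)}_i\}_{i=1}^d$ with $E^{(U)}_i=U|i\rangle\langle i|U^\dagger$. A learning network with $N=1$ use is a family $\mathbf R=\{R_i\}_{i=1}^d$ of positive semidefinite operators on $\mathcal H_2\otimes\mathcal H_1\otimes\mathcal H_0$ such that $\sum_iR_i=I_2\otimes I_1\otimes\rho_0$ with $\rho\ge0$, $\operatorname{Tr}\rho=1$. ($\mathcal H_0$ is the input of the inserted measurement, $\mathcal H_1$ carries its classical outcome, $\mathcal H_2$ is the input of the replicated measurement.) Its replicated POVM $\mathbf G^{(U)}=\{G_i^{(U)}\}$ on $\mathcal H_2$ is defined by $$(G^{(U)}_i)^T=\sum_{j=1}^d\big(\langle j|_1\otimes\langle j|_0U^\dagger\big)R_i\big(|j\rangle_1\otimes U|j\rangle_0\big).$$ The figure of merit is $$D[\mathbf R]=\int dU\int d\psi\sum_{i=1}^d\big|\langle\psi|E^{(U)}_i-G^{(U)}_i|\psi\rangle\big|^2,$$ where $dU$ is the normalized Haar measure on $SU(d)$ and $d\psi$ is the unitarily invariant probability measure on unit vectors of $\mathbb C^d$. *)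

(* Defs.v *)
From HB Require Import structures.
From mathcomp Require Import all_boot all_order all_algebra.
From mathcomp Require Import spectral sesquilinear.
From mathcomp Require Import complex mxtens.
From mathcomp Require Import all_classical all_reals all_analysis.

Set Implicit Arguments.
Unset Strict Implicit.
Unset Printing Implicit Defensive.

Import Order.TTheory GRing.Theory Num.Theory.
Import numFieldNormedType.Exports.

Local Open Scope classical_set_scope.
Local Open Scope ring_scope.
Local Open Scope sesquilinear_scope.

(* [R[i]] packed as a [numClosedFieldType], so that matrices over it inherit
   the topology given by the modulus. *)
Definition cplx (R : realType) : numClosedFieldType := R[i].

Section LinearAlgebra.
Context {R : realType}.

Definition ket {d : nat} (i : 'I_d) : 'cV[cplx R]_d := delta_mx i 0.

Definition ketbra {n : nat} (v : 'cV[cplx R]_n) : 'M[cplx R]_n := v *m v^t*.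

Definition expect {n : nat} (v : 'cV[cplx R]_n) (A : 'M[cplx R]_n) : cplx R :=
  (v^t* *m A *m v) 0 0.

(* In [cplx R], [0 <= z] means that [z] is real and nonnegative, so Hermiticity
   is implied. *)
Definition psd {n : nat} (A : 'M[cplx R]_n) : Prop :=
  forall v : 'cV[cplx R]_n, 0 <= expect v A.

End LinearAlgebra.

Definition SU_set (R : realType) (d : nat) : set 'M[cplx R]_d :=
  [set U | U \is unitarymx /\ \det U = 1].
Arguments SU_set : clear implicits.

Lemma SU_set_one (R : realType) (d : nat) :
  (1%:M : 'M[cplx R]_d) \in SU_set R d.
Proof.
apply/mem_set; split; last exact: det1.
by apply/unitarymxP; rewrite mul1mx trmx1 map_mx1.
Qed.

Lemma SU_set_mul (R : realType) (d : nat) (V U : SU_set R d) :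
  val V *m val U \in SU_set R d.
Proof.
case: V U => [V /set_mem[uV dV]] [U /set_mem[uU dU]] /=.
by apply/mem_set; split; [exact: mul_unitarymx|rewrite det_mulmx dV dU mulr1].
Qed.

(* [set_type] carries the subspace topology of the matrix topology. *)
Definition SUtop (R : realType) (d : nat) : Type := SU_set R d.
HB.instance Definition _ (R : realType) (d : nat) :=
  Topological.copy (SUtop R d) (set_type (SU_set R d)).
HB.instance Definition _ (R : realType) (d : nat) :=
  isPointed.Build (SUtop R d) (SigSub (SU_set_one R d)).

Definition SU (R : realType) (d : nat) :=
  g_sigma_algebraType (@open (SUtop R d)).

Definition SUmx (R : realType) (d : nat) (U : SU R d) : 'M[cplx R]_d :=
  val (U : SU_set R d).

Definition SUmul (R : realType) (d : nat) (V U : SU R d) : SU R d :=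
  SigSub (SU_set_mul V U).

Definition is_haar (R : realType) (d : nat)
    (mu : probability (SU R d) R) : Prop :=
  forall (V : SU R d) (A : set (SU R d)), measurable A ->
    mu (SUmul V @^-1` A) = mu A.

Definition sphere_set (R : realType) (d : nat) : set 'cV[cplx R]_d :=
  [set psi | psi^t* *m psi = 1%:M].
Arguments sphere_set : clear implicits.

Lemma sphere_set_point (R : realType) (d : nat) (hd : (1 < d)%N) :
  ket (Ordinal (ltnW hd)) \in sphere_set R d.
Proof.
apply/mem_set; rewrite /sphere_set/= /ket trmx_delta map_delta_mx mul_delta_mx.
by apply/matrixP => i j; rewrite !mxE !ord1.
Qed.

Lemma sphere_set_act (R : realType) (d : nat) (V : 'M[cplx R]_d)
    (hV : V \is unitarymx) (psi : sphere_set R d) :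
  V *m val psi \in sphere_set R d.
Proof.
case: psi => psi /set_mem/= psi1; apply/mem_set => /=.
rewrite /sphere_set/= trmx_mul map_mxM mulmxA -(mulmxA _ (V ^t*)).
suff -> : V^t* *m V = 1%:M by rewrite mulmx1.
by apply: mulmx1C; exact/unitarymxP.
Qed.

(* Measurable types are pointed in the library; the proof [hd] only serves to
   provide a base point. *)
Definition sphere_top (R : realType) (d : nat) (hd : (1 < d)%N) : Type :=
  sphere_set R d.
HB.instance Definition _ (R : realType) (d : nat) (hd : (1 < d)%N) :=
  Topological.copy (sphere_top R hd) (set_type (sphere_set R d)).
HB.instance Definition _ (R : realType) (d : nat) (hd : (1 < d)%N) :=
  isPointed.Build (sphere_top R hd) (SigSub (sphere_set_point R hd)).

Definition sphere (R : realType) (d : nat) (hd : (1 < d)%N) :=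
  g_sigma_algebraType (@open (sphere_top R hd)).

Definition sphere_vec (R : realType) (d : nat) (hd : (1 < d)%N)
    (psi : sphere R hd) : 'cV[cplx R]_d :=
  val (psi : sphere_set R d).

Definition sphere_act (R : realType) (d : nat) (hd : (1 < d)%N)
    (V : 'M[cplx R]_d) (hV : V \is unitarymx) (psi : sphere R hd) : sphere R hd :=
  SigSub (sphere_set_act hV psi).

Definition unitarily_invariant (R : realType) (d : nat) (hd : (1 < d)%N)
    (nu : probability (sphere R hd) R) : Prop :=
  forall (V : 'M[cplx R]_d) (hV : V \is unitarymx) (A : set (sphere R hd)),
    measurable A -> nu (sphere_act hV @^-1` A) = nu A.

Section Learning.
Context {R : realType} {d : nat}.
Implicit Types (U : 'M[cplx R]_d) (N : 'I_d -> 'M[cplx R]_(d * d * d)).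

(* Operators on H_2 (x) H_1 (x) H_0, the tensor factors being in this order. *)
Definition learning_network N : Prop :=
  (forall i, psd (N i)) /\
  exists rho : 'M[cplx R]_d,
    [/\ psd rho, \tr rho = 1 & \sum_i N i = 1%:M *t 1%:M *t rho].

Definition von_neumann U (i : 'I_d) : 'M[cplx R]_d := U *m ketbra (ket i) *m U^t*.

(* I_2 (x) |j>_1 (x) U|j>_0, as a map H_2 -> H_2 (x) H_1 (x) H_0. *)
Definition insertion U (j : 'I_d) : 'M[cplx R]_(d * d * d, d) :=
  castmx (erefl, etrans (muln1 (d * 1)) (muln1 d))
    (1%:M *t ket j *t (U *m ket j)).

Definition replicated N U (i : 'I_d) : 'M[cplx R]_d :=
  (\sum_j (insertion U j)^t* *m N i *m insertion U j)^T.

(* A_1 (x) B_20 as an operator on H_2 (x) H_1 (x) H_0. *)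
Definition tens_1_20 (A : 'M[cplx R]_d) (B : 'M[cplx R]_(d * d)) :
    'M[cplx R]_(d * d * d) :=
  \matrix_(x, y)
    let: (x21, x0) := mxtens_unindex x in let: (x2, x1) := mxtens_unindex x21 in
    let: (y21, y0) := mxtens_unindex y in let: (y2, y1) := mxtens_unindex y21 in
    A x1 y1 * B (mxtens_index (x2, x0)) (mxtens_index (y2, y0)).

Definition omega : 'cV[cplx R]_(d * d) := \sum_(n < d) ket n *t ket n.
Definition Pp : 'M[cplx R]_(d * d) := d%:R^-1 *: ketbra omega.
Definition Pq : 'M[cplx R]_(d * d) := 1%:M - Pp.

Definition opt_network (i : 'I_d) : 'M[cplx R]_(d * d * d) :=
  tens_1_20 (ketbra (ket i)) (d%:R^-1 *: Pp) +
  tens_1_20 (1%:M - ketbra (ket i)) ((d%:R * (d%:R - 1))^-1 *: Pq).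

End Learning.

(* The integrand is nonnegative, so the extended-real integral carries no
   convention for nonintegrable functions. *)
Definition figure_of_merit (R : realType) (d : nat) (hd : (1 < d)%N)
    (mu : probability (SU R d) R) (nu : probability (sphere R hd) R)
    (N : 'I_d -> 'M[cplx R]_(d * d * d)) : \bar R :=
  \int[mu]_U \int[nu]_psi
    (\sum_i complex.Re (`|expect (sphere_vec psi)
       (von_neumann (SUmx U) i - replicated N (SUmx U) i)| ^+ 2 : R[i]))%:E.

(* Main.v *)
(** Averaging over [psi] turns the figure of merit into the Haar average of
    [sum_i (Tr H_i^2 + (Tr H_i)^2) / (d (d + 1))] with [H_i = E_i - G_i].  This is
    a convex quadratic form of [H_i], and at the claimed optimum [H_i] equals
    [t (E_i - I / d)] with [t = (d^2 - d - 1) / (d (d - 1))].  The tangent bound at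
    that point leaves, since [sum_i H_i = 0], only the linear quantity
    [sum_i <U i| G_i |U i>], whose Haar average must be shown to be at most
    [(d + 1) / d].

    Both averages are fourth moments [E (u_a^* v_c u_b v_e^* )] of a pair of
    random vectors with a unitarily invariant law.  Such a tensor is a
    combination of [[a = b][c = e]] and [[b = e][c = a]], with coefficients
    determined by its two contractions.  The average fidelity thus only depends
    on the numbers [t_ij = Tr R_i^(jj)] and [o_ij = <omega| R_i^(jj) |omega>],
    where [R_i^(jj)] is the block [<j|_1 R_i |j>_1]; these satisfy
    [sum_i t_ij = d], [sum_i o_ij = 1] and [0 <= o_ij <= d t_ij], which gives
    the bound. *)

Require Import Defs.
From mathcomp Require Import all_boot all_order all_algebra all_fingroup.
From mathcomp Require Import all_classical all_reals all_analysis.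
From mathcomp Require Import measurable_realfun spectral sesquilinear.
From mathcomp Require Import complex mxtens ring.

Set Implicit Arguments.
Unset Strict Implicit.
Unset Printing Implicit Defensive.

Import Order.TTheory GRing.Theory Num.Theory.
Import numFieldNormedType.Exports.

Local Open Scope ring_scope.
Local Open Scope sesquilinear_scope.

(** * Integration of bounded complex functions *)

Section ComplexIntegral.
Context {dT : measure_display} {T : measurableType dT} {R : realType}.
Implicit Types (f g : T -> cplx R) (c : cplx R) (P : probability T R).

(** A uniform bound is built in so that the class is closed under products and each member is
    integrable against every probability measure; moments of any degree then need no separate
    integrability argument. *)
Definition bounded_measurable f : Prop :=
  [/\ measurable_fun [set: T] (fun x => complex.Re (f x)),
      measurable_fun [set: T] (fun x => complex.Im (f x)) &
      exists M : R, forall x, `|complex.Re (f x)| <= M /\ `|complex.Im (f x)| <= M].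

Definition Cint P f : cplx R :=
  Complex (\int[P]_x complex.Re (f x)) (\int[P]_x complex.Im (f x)).

Lemma ReD (z w : cplx R) : complex.Re (z + w) = complex.Re z + complex.Re w.
Proof. by case: z w => [? ?] [? ?]. Qed.

Lemma ImD (z w : cplx R) : complex.Im (z + w) = complex.Im z + complex.Im w.
Proof. by case: z w => [? ?] [? ?]. Qed.

Lemma ReM (z w : cplx R) : complex.Re (z * w) =
  complex.Re z * complex.Re w - complex.Im z * complex.Im w.
Proof. by case: z w => [? ?] [? ?]. Qed.

Lemma ImM (z w : cplx R) : complex.Im (z * w) =
  complex.Re z * complex.Im w + complex.Im z * complex.Re w.
Proof. by case: z w => [? ?] [? ?]. Qed.

Lemma Re_conj (z : cplx R) : complex.Re (z^*) = complex.Re z.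
Proof. by case: z. Qed.

Lemma Im_conj (z : cplx R) : complex.Im (z^*) = - complex.Im z.
Proof. by case: z. Qed.

Lemma eq_cplx (z w : cplx R) :
  complex.Re z = complex.Re w -> complex.Im z = complex.Im w -> z = w.
Proof. by case: z w => [? ?] [? ?] /= -> ->. Qed.

Lemma bounded_measurable_cst c : bounded_measurable (fun=> c).
Proof.
split; [exact: measurable_cst|exact: measurable_cst|].
exists (`|complex.Re c| + `|complex.Im c|) => x.
by rewrite lerDl lerDr !normr_ge0.
Qed.

Lemma bounded_measurableD f g : bounded_measurable f -> bounded_measurable g ->
  bounded_measurable (fun x => f x + g x).
Proof.
move=> [f1 f2 [M fM]] [g1 g2 [N gN]]; split.
- by under eq_fun do rewrite ReD; exact: measurable_funD.
- by under eq_fun do rewrite ImD; exact: measurable_funD.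
- exists (M + N) => x; rewrite ReD ImD.
  have [fM1 fM2] := fM x; have [gN1 gN2] := gN x.
  by split; apply: le_trans (ler_normD _ _) _; apply: lerD.
Qed.

Lemma bounded_measurableM f g : bounded_measurable f -> bounded_measurable g ->
  bounded_measurable (fun x => f x * g x).
Proof.
move=> [f1 f2 [M fM]] [g1 g2 [N gN]]; split.
- under eq_fun do rewrite ReM.
  by apply: measurable_funB; exact: measurable_funM.
- under eq_fun do rewrite ImM.
  by apply: measurable_funD; exact: measurable_funM.
- exists (M * N + M * N) => x; rewrite ReM ImM.
  have [fM1 fM2] := fM x; have [gN1 gN2] := gN x.
  split; [apply: le_trans (ler_normB _ _) _|apply: le_trans (ler_normD _ _) _];
    by apply: lerD; rewrite normrM ler_pM.
Qed.

Lemma bounded_measurable_conj f : bounded_measurable f ->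
  bounded_measurable (fun x => (f x)^*).
Proof.
move=> [f1 f2 [M fM]]; split.
- by under eq_fun do rewrite Re_conj.
- by under eq_fun do rewrite Im_conj; exact: measurableT_comp.
- by exists M => x; rewrite Re_conj Im_conj normrN.
Qed.

Lemma bounded_measurable_sum (I : Type) (r : seq I) (A : pred I)
    (F : I -> T -> cplx R) :
  (forall i, bounded_measurable (F i)) ->
  bounded_measurable (fun x => \sum_(i <- r | A i) F i x).
Proof.
move=> FB; elim: r => [|i r IH].
  rewrite (_ : (fun _ => _) = fun=> 0); first exact: bounded_measurable_cst.
  by apply/funext => x; rewrite big_nil.
rewrite (_ : (fun _ => _) = fun x => (if A i then F i x else 0) +
    \sum_(j <- r | A j) F j x); last first.
  by apply/funext => x; rewrite big_cons; case: ifP => // _; rewrite add0r.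
apply: bounded_measurableD => //.
by case: (A i) => //; exact: bounded_measurable_cst.
Qed.

Lemma integrable_Re P f : bounded_measurable f ->
  P.-integrable [set: T] (EFin \o (fun x => complex.Re (f x))).
Proof.
move=> [f1 _ [M fM]]; apply: measurable_bounded_integrable => //.
  by rewrite (le_lt_trans (probability_le1 _ _)) ?ltry.
exists M; split; first exact: num_real.
by move=> x Mx y _; exact: le_trans (fM y).1 (ltW Mx).
Qed.

Lemma integrable_Im P f : bounded_measurable f ->
  P.-integrable [set: T] (EFin \o (fun x => complex.Im (f x))).
Proof.
move=> [_ f1 [M fM]]; apply: measurable_bounded_integrable => //.
  by rewrite (le_lt_trans (probability_le1 _ _)) ?ltry.
exists M; split; first exact: num_real.
by move=> x Mx y _; exact: le_trans (fM y).2 (ltW Mx).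
Qed.

(** The bridge from the extended-real integrals of the figure of merit to [Cint]: boundedness makes
    the integral finite, so [fine] loses nothing. *)
Lemma integral_Re P f : bounded_measurable f ->
  (\int[P]_x (complex.Re (f x))%:E = (complex.Re (Cint P f))%:E)%E.
Proof.
by move=> fB; rewrite fineK//; apply: integrable_fin_num => //; exact: integrable_Re.
Qed.

Lemma Cint_cst P c : Cint P (fun=> c) = c.
Proof.
have PT : fine (P [set: T]%classic) = 1 := congr1 fine (probability_setT P).
by apply: eq_cplx; rewrite /Cint/= Rintegral_cst// -[RHS]mulr1; congr (_ * _).
Qed.

Lemma CintD P f g : bounded_measurable f -> bounded_measurable g ->
  Cint P (fun x => f x + g x) = Cint P f + Cint P g.
Proof.
move=> fB gB; apply: eq_cplx; rewrite ?ReD ?ImD /Cint/=.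
- under eq_Rintegral do rewrite ReD.
  by rewrite RintegralD//; exact: integrable_Re.
- under eq_Rintegral do rewrite ImD.
  by rewrite RintegralD//; exact: integrable_Im.
Qed.

Lemma CintZ P c f : bounded_measurable f ->
  Cint P (fun x => c * f x) = c * Cint P f.
Proof.
move=> fB.
have intZ (r : R) (h : T -> R) : P.-integrable [set: T] (EFin \o h) ->
    P.-integrable [set: T] (EFin \o (fun x => r * h x)).
  by move=> hi; apply: eq_integrable (integrableZl _ r hi).
apply: eq_cplx; rewrite ?ReM ?ImM /Cint/=.
- under eq_Rintegral do rewrite ReM.
  rewrite RintegralB//; last 2 first.
  + exact/intZ/integrable_Re.
  + exact/intZ/integrable_Im.
  by rewrite !RintegralZl//; [exact: integrable_Im|exact: integrable_Re].
- under eq_Rintegral do rewrite ImM.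
  rewrite RintegralD//; last 2 first.
  + exact/intZ/integrable_Im.
  + exact/intZ/integrable_Re.
  by rewrite !RintegralZl//; [exact: integrable_Re|exact: integrable_Im].
Qed.

Lemma Cint_sum P (I : Type) (r : seq I) (A : pred I) (F : I -> T -> cplx R) :
  (forall i, bounded_measurable (F i)) ->
  Cint P (fun x => \sum_(i <- r | A i) F i x) = \sum_(i <- r | A i) Cint P (F i).
Proof.
move=> FB; elim: r => [|i r IH].
  rewrite big_nil -[RHS](Cint_cst P); congr Cint.
  by apply/funext => x; rewrite big_nil.
rewrite big_cons -IH; case: ifP => Ai; last first.
  by congr Cint; apply/funext => x; rewrite big_cons Ai.
rewrite -CintD//; last exact: bounded_measurable_sum.
by congr Cint; apply/funext => x; rewrite big_cons Ai.
Qed.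

Lemma le_Re_Cint P f g : bounded_measurable f -> bounded_measurable g ->
  (forall x, complex.Re (f x) <= complex.Re (g x)) ->
  complex.Re (Cint P f) <= complex.Re (Cint P g).
Proof.
move=> fB gB fg; rewrite /Cint/=.
by apply: le_Rintegral => //; exact: integrable_Re.
Qed.

(** Change of variables: the integral of [f \o phi] is that of [f] against the pushforward of [P],
    which agrees with [P] on measurable sets. *)
Lemma Cint_invariant P (phi : T -> T) f : measurable_fun [set: T] phi ->
  (forall A, measurable A -> P (phi @^-1` A)%classic = P A) ->
  bounded_measurable f -> Cint P (fun x => f (phi x)) = Cint P f.
Proof.
move=> mphi Pphi fB.
have aux (h : T -> R) : measurable_fun [set: T] h ->
    P.-integrable [set: T] (EFin \o (fun x => h (phi x))) ->
    \int[P]_x h (phi x) = \int[P]_x h x.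
  move=> mh ih; rewrite /Rintegral; congr fine.
  transitivity (\int[pushforward P phi]_x (h x)%:E)%E.
    by rewrite integral_pushforward//; exact/measurable_EFinP.
  by apply: eq_measure_integral => A mA _; exact: Pphi.
have fphiB : bounded_measurable (fun x => f (phi x)).
  case: fB => f1 f2 [M fM]; split; last by exists M.
  - exact: measurableT_comp f1 mphi.
  - exact: measurableT_comp f2 mphi.
case: (fB) => f1 f2 _.
apply: eq_cplx; rewrite /Cint/=.
- by apply: (aux (fun x => complex.Re (f x))) => //; exact: integrable_Re fphiB.
- by apply: (aux (fun x => complex.Im (f x))) => //; exact: integrable_Im fphiB.
Qed.

End ComplexIntegral.

(** * Tensors invariant under the unitary group *)

Section InvariantTensor.
Context {C : numClosedFieldType} {d : nat}.

Definition phase_mx (k : 'I_d) : 'M[C]_d :=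
  diag_mx (\row_a (if a == k then 'i else 1)).

Lemma phase_mx_unitary k : phase_mx k \is unitarymx.
Proof.
apply/unitarymxP/matrixP => a b; rewrite mul_diag_mx !mxE.
have [<-|ab] := eqVneq a b; last by rewrite !mulr0n conjC0 mulr0.
by rewrite ?eqxx !mulr1n; case: ifP => _; rewrite ?conjC1 ?mulr1// -normCK normCi expr1n.
Qed.

Lemma phase_mxE k (u : 'cV[C]_d) a :
  (phase_mx k *m u) a 0 = (if a == k then 'i else 1) * u a 0.
Proof. by rewrite mul_diag_mx !mxE. Qed.

Lemma perm_mx_unitary (s : 'S_d) : (perm_mx s : 'M[C]_d) \is unitarymx.
Proof.
apply/unitarymxP; rewrite tr_perm_mx map_perm_mx -perm_mxM mulgV perm_mx1.
by [].
Qed.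

Lemma perm_mxE (s : 'S_d) (u : 'cV[C]_d) a : (perm_mx s *m u) a 0 = u (s a) 0.
Proof. by rewrite -row_permE mxE. Qed.

(** Here [p + q = 1] and [p - q = 'i] are square roots of 1 and -1, the eigenvalues of a
    transposition matrix [S]; hence [p + q S] is unitary with square [S]. *)
Let p : C := (1 + 'i) / 2.
Let q : C := (1 - 'i) / 2.

Lemma conj_half_i : p^* = q.
Proof. by rewrite /p /q rmorphM rmorphD/= conjC1 conjCi fmorphV/= conjC_nat. Qed.

Lemma conj_half_iC : q^* = p.
Proof. by rewrite -conj_half_i conjCK. Qed.

Lemma mul_half_i : p * q = 2^-1.
Proof.
have i2 : 'i * 'i = -1 :> C by rewrite -expr2 sqrCi.
rewrite /p /q.
have -> : (1 + 'i) / 2 * ((1 - 'i) / 2) = (1 - 'i * 'i) / 4 :> C by field.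
by rewrite i2; field.
Qed.

Lemma sqr_half_i : p * p + q * q = 0.
Proof.
have i2 : 'i * 'i = -1 :> C by rewrite -expr2 sqrCi.
rewrite /p /q.
have -> : (1 + 'i) / 2 * ((1 + 'i) / 2) + (1 - 'i) / 2 * ((1 - 'i) / 2)
   = (1 + 'i * 'i) / 2 :> C by field.
by rewrite i2 subrr mul0r.
Qed.

(* A unitary square root of the transposition matrix of [k] and [l]; it relates
   the entry [T k k k k] to the other two kinds of nonzero entries. *)
Definition sqrt_swap_mx (k l : 'I_d) : 'M[C]_d :=
  p%:M + q *: perm_mx (tperm k l).

(** With [S] Hermitian and [S^2 = 1], the product [(p + q S) (q + p S)] equals
    [2 p q + (p^2 + q^2) S], which is 1. *)
Lemma sqrt_swap_mx_unitary k l : sqrt_swap_mx k l \is unitarymx.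
Proof.
apply/unitarymxP; rewrite /sqrt_swap_mx.
rewrite linearD/= map_mxD linearZ/= map_mxZ tr_scalar_mx map_scalar_mx/=.
rewrite tr_perm_mx map_perm_mx tpermV conj_half_i conj_half_iC.
rewrite mulmxDl !mulmxDr -!scalemxAl -!scalemxAr -perm_mxM tperm2 perm_mx1.
rewrite mul_scalar_mx mul_mx_scalar scale_scalar_mx scalemx1 !scalerA.
rewrite mul_scalar_mx scalerA scale_scalar_mx [q * p]mulrC mul_half_i.
rewrite -addrA (addrA (_ *: _)) -scalerDl sqr_half_i scale0r add0r -raddfD/=.
by congr (_%:M); field.
Qed.

Lemma sqrt_swap_mxE k l (u : 'cV[C]_d) :
  (sqrt_swap_mx k l *m u) k 0 = p * u k 0 + q * u l 0.
Proof.
rewrite mulmxDl mul_scalar_mx -scalemxAl mxE [(p *: u) k 0]mxE; congr (_ + _).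
by rewrite mxE perm_mxE tpermL.
Qed.

End InvariantTensor.

Section Tensor.
Context {C : numClosedFieldType} {d : nat}.
Variable T : 'I_d -> 'I_d -> 'I_d -> 'I_d -> C.
Let p : C := (1 + 'i) / 2.
Let q : C := (1 - 'i) / 2.
Let ph (k a : 'I_d) : C := if a == k then 'i else 1.

(** Unitary invariance enters only through three families: single phases, permutations and square
    roots of transpositions. Indices [a] and [e] belong to conjugated factors, [c] and [b] to plain
    ones. *)
Hypothesis Tphase : forall k a c b e,
  T a c b e = (ph k a)^* * ph k c * ph k b * (ph k e)^* * T a c b e.
Hypothesis Tperm : forall (s : 'S_d) a c b e,
  T a c b e = T (s a) (s c) (s b) (s e).
Let w (x : bool) := if x then p else q.
Hypothesis Tswap : forall k l, k != l ->
  let z (x : bool) := if x then k else l in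
  T k k k k = \sum_x1 \sum_x2 \sum_x3 \sum_x4
    (w x1)^* * w x2 * w x3 * (w x4)^* * T (z x1) (z x2) (z x3) (z x4).

Let eq1_mul0 (x t : C) : x != 1 -> t = x * t -> t = 0.
Proof.
move=> x1 xt; apply/eqP; move: xt => /eqP.
rewrite -subr_eq0 -{1}[t]mul1r -mulrBl mulf_eq0 subr_eq0 eq_sym (negbTE x1).
by [].
Qed.

Let i_neq1 : 'i != 1 :> C.
Proof.
apply/eqP => i1; have := sqrCi C; rewrite i1 expr1n => /eqP.
by rewrite -subr_eq0 opprK -mulr2n pnatr_eq0.
Qed.

Let ii : 'i * 'i = -1 :> C. Proof. by rewrite -expr2 sqrCi. Qed.

Let m1_neq1 : -1 != 1 :> C.
Proof. by rewrite eq_sym -subr_eq0 opprK -mulr2n pnatr_eq0. Qed.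

Let iJi : 'i^* * 'i = 1 :> C.
Proof. by rewrite conjCi mulNr ii opprK. Qed.

(** If the conjugated indices [a, e] are not a rearrangement of the plain indices [c, b], then some
    phase matrix multiplies the entry by ['i] or -1; being invariant, the entry vanishes. *)
Lemma invariant_tensor_support a c b e :
  ~~ ((a == b) && (c == e) || (b == e) && (c == a)) -> T a c b e = 0.
Proof.
have [<-{b}|ab] := eqVneq a b => /= [|].
  rewrite negb_or => /andP[ce _].
  apply: (@eq1_mul0 'i) => //.
  rewrite {1}(Tphase c) /ph eqxx [e == c]eq_sym (negbTE ce) conjC1.
  case: (a == c); rewrite ?conjC1 ?mulr1 ?mul1r//.
  by rewrite iJi mul1r.
have [<-{e}|be] := eqVneq b e => /= [ca|_].
  apply: (@eq1_mul0 'i) => //.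
  rewrite {1}(Tphase c) /ph eqxx [a == c]eq_sym (negbTE ca) conjC1 mul1r.
  case: (b == c); rewrite ?conjC1 ?mulr1 ?mul1r//.
  by rewrite -[_ * _^*]mulrA [_ * _^*]mulrC iJi mulr1.
have := Tphase b a c b e; rewrite /ph eqxx (negbTE ab) [e == b]eq_sym (negbTE be).
rewrite conjC1 mul1r mulr1; case: (c == b); rewrite ?mul1r.
  by rewrite ii; exact: eq1_mul0.
exact: eq1_mul0.
Qed.

Lemma invariant_tensor_eq a c b e :
  T a c b e = if (a == b) && (c == e) || (b == e) && (c == a)
              then T a c b e else 0.
Proof. by case: ifPn => // /invariant_tensor_support. Qed.

(** Double transitivity of the symmetric group: move [a] to [k], then the image of [c] to [l] by a
    transposition fixing [k]. *)
Let to_pair (k l a c : 'I_d) : k != l -> a != c ->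
  exists s : 'S_d, s a = k /\ s c = l.
Proof.
move=> kl ac; pose c1 := tperm a k c.
have c1k : c1 != k by rewrite -(tpermL a k) (inj_eq perm_inj) eq_sym.
exists (tperm a k * tperm c1 l)%g; rewrite !permM tpermL tpermL; split => //.
by rewrite tpermD// eq_sym.
Qed.

(** By the support lemma and double transitivity only three values remain: [T k l k l], [T k k l l]
    and the fully diagonal one. Both delta terms are active on the diagonal, so what has to be shown
    is that the third value is the sum of the other two; this comes from [Tswap]. *)
Lemma invariant_tensorE (hd : (1 < d)%N) : exists B G : C, forall a c b e,
  T a c b e = B * ((a == b) && (c == e))%:R + G * ((b == e) && (c == a))%:R.
Proof.
pose k := Ordinal (ltnW hd); pose l := Ordinal hd.
have kl : k != l by [].
have TB a c : a != c -> T a c a c = T k l k l.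
  by move=> /(to_pair kl)[s [sa sc]]; rewrite (Tperm s) sa sc.
have TG a c : a != c -> T a a c c = T k k l l.
  by move=> /(to_pair kl)[s [sa sc]]; rewrite (Tperm s) sa sc.
have TA a : T a a a a = T k l k l + T k k l l.
  have V a' c b e := @invariant_tensor_support a' c b e.
  have lk : (l == k) = false by rewrite eq_sym (negbTE kl).
  have kl' := negbTE kl.
  rewrite (Tperm (tperm a k)) tpermL.
  (* Of the 16 terms 10 vanish by support. The other six all carry the coefficient [(p q)^2 = 1/4],
     which gives [t = (2 t + 2 B + 2 G) / 4], that is [t = B + G]. *)
  have := Tswap kl; cbv zeta; rewrite !big_bool/= !conj_half_i !conj_half_iC.
  rewrite (V k k l k) ?eqxx ?kl' ?lk// (V k l k k) ?eqxx ?kl' ?lk// (V k l l k) ?eqxx ?kl' ?lk// (V l k k l) ?eqxx ?kl' ?lk// (V l k l l) ?eqxx ?kl' ?lk// (V l l k l) ?eqxx ?kl' ?lk// (V k k k l) ?eqxx ?kl' ?lk// (V k l l l) ?eqxx ?kl' ?lk// (V l k k k) ?eqxx ?kl' ?lk// (V l l l k) ?eqxx ?kl' ?lk//.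
  rewrite (Tperm (tperm k l) l l l l) (Tperm (tperm k l) l k l k).
  rewrite (Tperm (tperm k l) l l k k) !tpermL !tpermR.
  rewrite -/p -/q; move: (T k k k k) (T k l k l) (T k k l l) => t B G E.
  have {}E : 2 * t = 2 * (p * q * (p * q) * (2 * t + 2 * B + 2 * G)).
    by congr (_ * _); rewrite {1}E; ring.
  rewrite mul_half_i in E.
  apply: (addrI t); transitivity (2 * t); first by ring.
  by rewrite E; field.
exists (T k l k l), (T k k l l) => a c b e; rewrite invariant_tensor_eq.
have [/andP[/eqP <- /eqP <-]|n1] := boolP ((a == b) && (c == e)).
  rewrite [c == a]eq_sym andbb /= mulr1.
  by have [->|ac] := eqVneq a c; rewrite ?mulr1 ?TA// mulr0 addr0 TB.
rewrite mulr0 add0r /=; case: ifPn => [/andP[/eqP be /eqP ca]|_].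
  move: n1; rewrite -be ca andbb => ab.
  by rewrite mulr1 TG.
by rewrite mulr0.
Qed.

End Tensor.

(** * Fourth moments of invariant random vectors *)

Section Moments.
Context {dT : measure_display} {T : measurableType dT} {R : realType} {d : nat}.
Variable P : probability T R.
Local Notation C := (cplx R).
Implicit Types u v : T -> 'cV[C]_d.

Definition moment4 u v (a c b e : 'I_d) : C :=
  Cint P (fun t => (u t a 0)^* * v t c 0 * u t b 0 * (v t e 0)^*).

Lemma bounded_measurable_mono (f g h k : T -> C) :
  bounded_measurable f -> bounded_measurable g ->
  bounded_measurable h -> bounded_measurable k ->
  bounded_measurable (fun t => (f t)^* * g t * h t * (k t)^*).
Proof.
move=> fB gB hB kB; apply: bounded_measurableM; last exact: bounded_measurable_conj.
apply: bounded_measurableM => //; apply: bounded_measurableM => //.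
exact: bounded_measurable_conj.
Qed.

Section Invariant.
Variables u v : T -> 'cV[C]_d.
Hypothesis uB : forall a, bounded_measurable (fun t => u t a 0).
Hypothesis vB : forall a, bounded_measurable (fun t => v t a 0).

(** One multilinear expansion serves all three families of matrices: [I] has one element for phases
    and permutations, two for [sqrt_swap_mx]. The row formula is asked only at the indices in play,
    because for [sqrt_swap_mx] it is available only at row [k]. *)
Lemma moment4_lin (I : finType) (V : 'M[C]_d) (w : 'I_d -> I -> C)
    (z : 'I_d -> I -> 'I_d) (a c b e : 'I_d) :
  (forall x, x \in [:: a; c; b; e] -> forall y : 'cV[C]_d,
     (V *m y) x 0 = \sum_i w x i * y (z x i) 0) ->
  moment4 (fun t => V *m u t) (fun t => V *m v t) a c b e =
  \sum_i \sum_j \sum_k \sum_l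
    (w a i)^* * w c j * w b k * (w e l)^* *
    moment4 u v (z a i) (z c j) (z b k) (z e l).
Proof.
move=> VE.
have mB i j k l : bounded_measurable (fun t => (u t (z a i) 0)^* *
    v t (z c j) 0 * u t (z b k) 0 * (v t (z e l) 0)^*).
  exact: bounded_measurable_mono.
transitivity (Cint P (fun t => \sum_i \sum_j \sum_k \sum_l
    (w a i)^* * w c j * w b k * (w e l)^* *
    ((u t (z a i) 0)^* * v t (z c j) 0 * u t (z b k) 0 * (v t (z e l) 0)^*))).
  congr Cint; apply/funext => t; rewrite !VE ?inE ?eqxx ?orbT//.
  rewrite !rmorph_sum/= -!mulrA big_distrl/=; apply: eq_bigr => i _.
  rewrite big_distrl big_distrr/=; apply: eq_bigr => j _.
  rewrite big_distrl !big_distrr/=; apply: eq_bigr => k _.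
  rewrite !big_distrr/=; apply: eq_bigr => l _.
  rewrite !rmorphM/=; ring.
have cB i j k l : bounded_measurable (fun t =>
    (w a i)^* * w c j * w b k * (w e l)^* *
    ((u t (z a i) 0)^* * v t (z c j) 0 * u t (z b k) 0 * (v t (z e l) 0)^*)).
  by apply: bounded_measurableM => //; exact: bounded_measurable_cst.
rewrite Cint_sum; last by move=> i; do 3! apply: bounded_measurable_sum => ?.
apply: eq_bigr => i _; rewrite Cint_sum; last first.
  by move=> j; do 2! apply: bounded_measurable_sum => ?.
apply: eq_bigr => j _; rewrite Cint_sum; last first.
  by move=> k; apply: bounded_measurable_sum => ?.
apply: eq_bigr => k _; rewrite Cint_sum//.
by apply: eq_bigr => l _; rewrite CintZ.
Qed.

Hypothesis hd : (1 < d)%N.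
Hypothesis inv : forall V : 'M[C]_d, V \is unitarymx -> forall a c b e,
  moment4 (fun t => V *m u t) (fun t => V *m v t) a c b e = moment4 u v a c b e.
Hypothesis u1 : forall t, \sum_a (u t a 0)^* * u t a 0 = 1.
Hypothesis v1 : forall t, \sum_a (v t a 0)^* * v t a 0 = 1.
Variable kappa : C.
Hypothesis uv : forall t, \sum_a (u t a 0)^* * v t a 0 = kappa.

Lemma moment4_tensor : exists B G : C, forall a c b e,
  moment4 u v a c b e =
    B * ((a == b) && (c == e))%:R + G * ((b == e) && (c == a))%:R.
Proof.
apply: invariant_tensorE => //.
- move=> k a c b e; rewrite -[LHS](inv (phase_mx_unitary k)).
  rewrite (moment4_lin (I := 'I_1) (w := fun x _ => if x == k then 'i else 1)
    (z := fun x _ => x)); last first.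
    by move=> x _ y; rewrite phase_mxE big_ord1.
  by rewrite !big_ord1.
- move=> s a c b e; rewrite -[LHS](inv (perm_mx_unitary s)).
  rewrite (moment4_lin (I := 'I_1) (w := fun x _ => 1) (z := fun x _ => s x)); last first.
    by move=> x _ y; rewrite perm_mxE big_ord1 mul1r.
  by rewrite !big_ord1; rewrite conjC1 !mul1r.
- move=> k l kl z; rewrite -[LHS](inv (sqrt_swap_mx_unitary k l)).
  apply: (moment4_lin (I := bool)
    (w := fun _ x => if x then (1 + 'i) / 2 else (1 - 'i) / 2)
    (z := fun _ x => if x then k else l)).
  move=> x; rewrite !inE !orbb => /eqP -> y.
  by rewrite sqrt_swap_mxE big_bool.
Qed.

Let sum_delta2 (F : 'I_d -> 'I_d -> C) : (forall a c, F a c = (a == c)%:R) ->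
  \sum_a \sum_c F a c = d%:R.
Proof.
move=> FE; transitivity (\sum_(a < d) (1 : C)).
  apply: eq_bigr => a _; rewrite (bigD1 a)//= FE eqxx big1 ?addr0// => c ca.
  by rewrite FE eq_sym (negbTE ca).
by rewrite sumr_const card_ord.
Qed.

Let sum_one2 : \sum_(a < d) \sum_(c < d) (1 : C) = d%:R ^+ 2.
Proof. by rewrite !sumr_const card_ord -natrX -mulnn mulrnA. Qed.

(** Contracting [a = b, c = e] gives the product of the squared norms, which is 1; contracting
    [a = c, b = e] gives [|<u, v>|^2]. These are two linear equations for [B] and [G], solved by
    elimination. *)
Lemma moment4E a c b e : moment4 u v a c b e =
  (d%:R - `|kappa| ^+ 2) / (d%:R * (d%:R ^+ 2 - 1)) * ((a == b) && (c == e))%:R +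
  (d%:R * `|kappa| ^+ 2 - 1) / (d%:R * (d%:R ^+ 2 - 1)) * ((b == e) && (c == a))%:R.
Proof.
have [B [G BG]] := moment4_tensor.
have mB x y z w : bounded_measurable (fun t =>
    (u t x 0)^* * v t y 0 * u t z 0 * (v t w 0)^*).
  exact: bounded_measurable_mono.
have E1 : B * d%:R ^+ 2 + G * d%:R = 1.
  transitivity (\sum_a \sum_c moment4 u v a c a c).
    under eq_bigr => x _. under eq_bigr => y _ do rewrite BG. over.
    rewrite -sum_one2 -(@sum_delta2 (fun x y => ((x == y) && (y == x))%:R)); last first.
      by move=> x y; rewrite [y == x]eq_sym andbb.
    rewrite !mulr_sumr -big_split/=; apply: eq_bigr => x _.
    rewrite !mulr_sumr -big_split/=; apply: eq_bigr => y _.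
    by rewrite !eqxx.
  transitivity (Cint P (fun t => \sum_a \sum_c
      (u t a 0)^* * v t c 0 * u t a 0 * (v t c 0)^*)).
    rewrite Cint_sum; last by move=> x; apply: bounded_measurable_sum.
    by apply: eq_bigr => x _; rewrite Cint_sum.
  rewrite -[RHS](Cint_cst P); congr Cint; apply/funext => t.
  rewrite -[RHS]mulr1 -{1}(u1 t) -(v1 t) big_distrl/=.
  apply: eq_bigr => x _; rewrite big_distrr/=; apply: eq_bigr => y _; ring.
have E2 : B * d%:R + G * d%:R ^+ 2 = `|kappa| ^+ 2.
  transitivity (\sum_a \sum_b moment4 u v a a b b).
    under eq_bigr => x _. under eq_bigr => y _ do rewrite BG. over.
    rewrite -sum_one2 -(@sum_delta2 (fun x y => ((x == y) && (x == y))%:R)); last first.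
      by move=> x y; rewrite andbb.
    rewrite !mulr_sumr -big_split/=; apply: eq_bigr => x _.
    rewrite !mulr_sumr -big_split/=; apply: eq_bigr => y _.
    by rewrite !eqxx.
  transitivity (Cint P (fun t => \sum_a \sum_b
      (u t a 0)^* * v t a 0 * u t b 0 * (v t b 0)^*)).
    rewrite Cint_sum; last by move=> x; apply: bounded_measurable_sum.
    by apply: eq_bigr => x _; rewrite Cint_sum.
  rewrite -[RHS](Cint_cst P); congr Cint; apply/funext => t.
  rewrite normCK -{2}(uv t) rmorph_sum/= -(uv t) big_distrl/=.
  apply: eq_bigr => x _; rewrite big_distrr/=; apply: eq_bigr => y _.
  rewrite rmorphM/= conjCK; ring.
have d0 : d%:R != 0 :> C by rewrite pnatr_eq0 -lt0n ltnW.
have d1 : d%:R ^+ 2 - 1 != 0 :> C.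
  by rewrite subr_eq0 -natrX pnatr_eq1 -(exp1n 2) eqn_exp2r// gtn_eqF.
have D0 : d%:R * (d%:R ^+ 2 - 1) != 0 :> C by rewrite mulf_neq0.
rewrite BG; congr (_ * _ + _ * _); apply: (canRL (mulfK D0)).
- transitivity (d%:R * (B * d%:R ^+ 2 + G * d%:R) -
    (B * d%:R + G * d%:R ^+ 2)); first by ring.
  by rewrite E1 E2 mulr1.
- transitivity (d%:R * (B * d%:R + G * d%:R ^+ 2) -
    (B * d%:R ^+ 2 + G * d%:R)); first by ring.
  by rewrite E1 E2.
Qed.

End Invariant.
End Moments.

(** * The special unitary group and the unit sphere *)

Section Topology.
Local Open Scope classical_set_scope.
Context {R : realType}.
Local Notation C := (cplx R).

(** Balls of [cplx R] have radii in [cplx R] itself, so a real radius enters as [Complex e 0]. *)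
Lemma near_norm_lt (z : C) (e : R) : 0 < e ->
  \forall w \near z, `|z - w| < Complex e 0 :> C.
Proof.
move=> e0; apply/nbhs_ballP; exists (Complex e 0) => /=.
  by rewrite ltcE /= eqxx.
by move=> w; rewrite /ball/=.
Qed.

Lemma Re_Im_lt_norm (z : C) (e : R) : `|z| < Complex e 0 :> C ->
  `|complex.Re z| < e /\ `|complex.Im z| < e.
Proof.
case: z => a b; rewrite normc_def /= ltcE/= eqxx/= => H.
split; apply: le_lt_trans H; rewrite -sqrtr_sqr ler_wsqrtr// ?lerDl ?lerDr sqr_ge0//.
Qed.

Lemma continuous_Re : continuous (fun z : C => complex.Re z : R).
Proof.
move=> z; apply/(@cvgrPdist_lt _ _ _ (nbhs z) _) => e e0.
apply: filterS (near_norm_lt z e0) => w /Re_Im_lt_norm[+ _].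
by case: z w => ? ? [? ?].
Qed.

Lemma continuous_Im : continuous (fun z : C => complex.Im z : R).
Proof.
move=> z; apply/(@cvgrPdist_lt _ _ _ (nbhs z) _) => e e0.
apply: filterS (near_norm_lt z e0) => w /Re_Im_lt_norm[_ +].
by case: z w => ? ? [? ?].
Qed.

(** A matrix neighbourhood is given by one neighbourhood per entry, and the finitely many entrywise
    conditions hold near [x] simultaneously. *)
Lemma continuous_mx (X : topologicalType) (m n : nat) (f : X -> 'M[C]_(m, n)) :
  (forall i j, continuous (fun x => f x i j)) -> continuous f.
Proof.
move=> fc x A [P MP PA].
have : \forall y \near x, forall ij : 'I_m * 'I_n, P ij.1 ij.2 (f y ij.1 ij.2).
  by apply: filter_forall => -[i j]; exact: fc (MP i j).
by apply: filterS => y Py; apply: PA => i j; exact: (Py (i, j)).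
Qed.

Lemma continuous_entry (X : topologicalType) (m n : nat) (f : X -> 'M[C]_(m, n)) :
  continuous f -> forall i j, continuous (fun x => f x i j).
Proof.
move=> fc i j x; apply: (@continuous_comp _ _ _ f (fun M : 'M[C]_(m, n) => M i j)).
  exact: fc.
exact: coord_continuous.
Qed.

Lemma continuous_mulmxl (X : topologicalType) (l m n : nat) (V : 'M[C]_(l, m))
    (f : X -> 'M[C]_(m, n)) :
  continuous f -> continuous (fun x => V *m f x).
Proof.
move=> fc; apply: continuous_mx => i j.
rewrite (_ : (fun _ => _) = fun x => \sum_k V i k * f x k j); last first.
  by apply/funext => y; rewrite mxE.
apply: continuous_big; first exact: add_continuous.
move=> k _ x; apply: cvgM; first exact: cvg_cst.
exact: continuous_entry.
Qed.

Lemma continuous_measurable_borel (X : ptopologicalType)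
    (f : g_sigma_algebraType (@open X) -> R) :
  continuous (f : X -> R) -> measurable_fun [set: g_sigma_algebraType (@open X)] f.
Proof.
move=> fc; apply: (measurability _ (RGenOInfty.measurableE R)) => //.
move=> _ [_ [a ->] <-]; rewrite setTI; apply: sub_sigma_algebra.
by move/continuousP: fc; apply; exact: interval_open.
Qed.

Lemma continuous_measurable_borel_self (X : ptopologicalType)
    (f : g_sigma_algebraType (@open X) -> g_sigma_algebraType (@open X)) :
  continuous (f : X -> X) -> measurable_fun [set: g_sigma_algebraType (@open X)] f.
Proof.
move=> fc; apply: (@measurability _ _ (g_sigma_algebraType (@open X))
  (g_sigma_algebraType (@open X)) setT f (@open X)) => //.
move=> _ [A oA <-]; rewrite setTI; apply: sub_sigma_algebra.
by move/continuousP: fc; apply.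
Qed.

Lemma continuous_to_subtype (X Y : topologicalType) (A : set Y) (f : X -> A) :
  continuous (fun x => val (f x) : Y) -> continuous f.
Proof. exact: continuous_comp_initial. Qed.

Lemma unit_vector_bound (d : nat) (x : 'I_d -> C) :
  \sum_a (x a)^* * x a = 1 -> forall a, 
  `|complex.Re (x a)| <= 1 /\ `|complex.Im (x a)| <= 1.
Proof.
move=> x1 a.
have : (x a)^* * x a <= 1.
  rewrite -x1 (bigD1 a)//= lerDl; apply: sumr_ge0 => b _.
  by rewrite mulrC mul_conjC_ge0.
case: (x a) => r s; rewrite lecE /= => /andP H; case: H => _.
rewrite mulNr opprK -!expr2 => rs1.
split; rewrite -(@ler_pXn2r _ 2)// ?nnegrE// expr1n real_normK ?num_real//.
  by apply: le_trans rs1; rewrite lerDl sqr_ge0.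
by apply: le_trans rs1; rewrite lerDr sqr_ge0.
Qed.

End Topology.

(** * Haar moments of the columns of a special unitary matrix *)

Section SpecialUnitary.
Local Open Scope classical_set_scope.
Context {R : realType} {d : nat}.
Local Notation C := (cplx R).
Implicit Types (U : SU R d).

Lemma continuous_SUmx : continuous (fun U : SUtop R d => SUmx (U : SU R d)).
Proof. exact: initial_continuous. Qed.

Lemma SUmx_unitary U : SUmx U \is unitarymx.
Proof. by rewrite /SUmx; have /set_mem[] := valP (U : SU_set R d). Qed.

Lemma unitary_ket_ip (U : 'M[C]_d) (i j : 'I_d) : U \is unitarymx ->
  \sum_a ((U *m ket i) a 0)^* * (U *m ket j) a 0 = (i == j)%:R.
Proof.
move=> Uu; have UU : U^t* *m U = 1%:M by apply: mulmx1C; exact/unitarymxP.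
have := congr1 (fun M : 'M[C]_d => M i j) UU.
rewrite !mxE => <-; apply: eq_bigr => a _.
by rewrite -!colE !mxE.
Qed.

Lemma measurable_SUmul (V : SU R d) : measurable_fun [set: SU R d] (SUmul V).
Proof.
apply: (@continuous_measurable_borel_self (SUtop R d)).
apply: continuous_to_subtype.
apply: (@continuous_mulmxl R (SUtop R d)); exact: continuous_SUmx.
Qed.

Lemma bounded_measurable_SU_ket (i a : 'I_d) :
  bounded_measurable (fun U : SU R d => (SUmx U *m ket i) a 0).
Proof.
have cE : continuous (fun U : SUtop R d => (SUmx (U : SU R d) *m ket i) a 0).
  rewrite (_ : (fun _ => _) = fun U : SUtop R d => SUmx (U : SU R d) a i).
    exact/continuous_entry/continuous_SUmx.
  by apply/funext => W; rewrite -colE mxE.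
split.
- apply: (@continuous_measurable_borel _ (SUtop R d)) => U.
  by apply: continuous_comp; [exact: cE|exact: continuous_Re].
- apply: (@continuous_measurable_borel _ (SUtop R d)) => U.
  by apply: continuous_comp; [exact: cE|exact: continuous_Im].
- exists 1 => U; apply: (@unit_vector_bound _ _ (fun a => (SUmx U *m ket i) a 0)).
  by rewrite (unitary_ket_ip _ _ (SUmx_unitary U)) eqxx.
Qed.

(** Take for [z] a [d]-th root of the inverse determinant; it has modulus one because the
    determinant has. *)
Lemma unitary_phase_SU (V : 'M[C]_d) (hd : (0 < d)%N) : V \is unitarymx ->
  exists z : C, z^* * z = 1 /\ (z *: V) \in SU_set R d.
Proof.
move=> Vu; pose z := d.-root (\det V)^-1.
have zd : z ^+ d = (\det V)^-1 by rewrite rootCK.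
have detV : `|\det V| = 1.
  have := congr1 determinant (unitarymxP Vu).
  rewrite det_mulmx det1 det_map_mx det_tr -normCK => /eqP.
  by rewrite pexpr_eq1// => /eqP.
have z1 : z^* * z = 1.
  rewrite mulrC -normCK; apply/eqP; rewrite pexpr_eq1//.
  by rewrite -(@pexpr_eq1 _ _ d)// -normrX zd normfV detV invr1.
have detV0 : \det V != 0 by rewrite -normr_eq0 detV oner_eq0.
exists z; split => //; apply/mem_set; split; last first.
  by rewrite detZ zd mulVf.
apply/unitarymxP; rewrite linearZ/= map_mxZ/= -scalemxAl -scalemxAr scalerA.
by rewrite mulrC z1 scale1r; exact/unitarymxP.
Qed.

(** Haar invariance only concerns matrices of determinant one, whereas the phase and permutation
    matrices may have another determinant. Rescaling [V] into the group costs nothing: the moment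
    has two conjugated and two plain factors, so the phases cancel. *)
Lemma haar_moment4_invariant (mu : probability (SU R d) R) (hd : (0 < d)%N)
    (i j : 'I_d) (V : 'M[C]_d) :
  is_haar mu -> V \is unitarymx -> forall a c b e,
  moment4 mu (fun U => V *m (SUmx U *m ket i)) (fun U => V *m (SUmx U *m ket j)) a c b e
  = moment4 mu (fun U => SUmx U *m ket i) (fun U => SUmx U *m ket j) a c b e.
Proof.
move=> hmu /(unitary_phase_SU hd)[z [z1 zV]] a c b e.
pose W : SU R d := SigSub zV.
rewrite /moment4 -[RHS](Cint_invariant (@measurable_SUmul W) (hmu W)); last first.
  by apply: bounded_measurable_mono; exact: bounded_measurable_SU_ket.
congr Cint; apply/funext => U.
have WE k x : (SUmx (SUmul W U) *m ket k) x 0 = z * (V *m (SUmx U *m ket k)) x 0.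
  by rewrite /SUmx /SUmul /= -scalemxAl -scalemxAl mxE mulmxA.
rewrite !WE !rmorphM/=; set x1 := (_ a 0)^*; set x2 := _ c 0.
set x3 := _ b 0; set x4 := (_ e 0)^*.
transitivity ((z^* * z) * (z^* * z) * (x1 * x2 * x3 * x4)); last by ring.
by rewrite z1 !mul1r.
Qed.

Lemma haar_moment4E (mu : probability (SU R d) R) (hd : (1 < d)%N)
    (i j a c b e : 'I_d) : is_haar mu ->
  moment4 mu (fun U => SUmx U *m ket i) (fun U => SUmx U *m ket j) a c b e =
  (d%:R - (i == j)%:R) / (d%:R * (d%:R ^+ 2 - 1)) * ((a == b) && (c == e))%:R +
  (d%:R * (i == j)%:R - 1) / (d%:R * (d%:R ^+ 2 - 1)) * ((b == e) && (c == a))%:R.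
Proof.
move=> hmu.
rewrite (@moment4E _ _ _ _ mu _ _ _ _ hd _ _ _ (i == j)%:R).
- by case: (i == j); rewrite ?normr1 ?normr0 ?expr1n ?expr0n.
- exact: bounded_measurable_SU_ket.
- exact: bounded_measurable_SU_ket.
- by move=> V Vu *; apply: haar_moment4_invariant => //; exact: ltnW.
- by move=> U; rewrite (unitary_ket_ip _ _ (SUmx_unitary U)) eqxx.
- by move=> U; rewrite (unitary_ket_ip _ _ (SUmx_unitary U)) eqxx.
- by move=> U; rewrite (unitary_ket_ip _ _ (SUmx_unitary U)).
Qed.

End SpecialUnitary.

(** * Moments of a uniformly distributed unit vector *)

Section Sphere.
Local Open Scope classical_set_scope.
Context {R : realType} {d : nat} (hd : (1 < d)%N).
Local Notation C := (cplx R).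
Implicit Types (psi : sphere R hd).

Lemma continuous_sphere_vec :
  continuous (fun psi : sphere_top R hd => sphere_vec (psi : sphere R hd)).
Proof. exact: initial_continuous. Qed.

Lemma sphere_vec_norm psi :
  \sum_a (sphere_vec psi a 0)^* * sphere_vec psi a 0 = 1.
Proof.
have /set_mem psi1 := valP (psi : sphere_set R d).
have := congr1 (fun M : 'M[C]_1 => M 0 0) psi1; rewrite !mxE eqxx mulr1n => <-.
by apply: eq_bigr => a _; rewrite !mxE.
Qed.

Lemma measurable_sphere_act (V : 'M[C]_d) (Vu : V \is unitarymx) :
  measurable_fun [set: sphere R hd] (@sphere_act R d hd V Vu).
Proof.
apply: (@continuous_measurable_borel_self (sphere_top R hd)).
apply: continuous_to_subtype.
apply: (@continuous_mulmxl R (sphere_top R hd)); exact: continuous_sphere_vec.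
Qed.

Lemma bounded_measurable_sphere_vec (a : 'I_d) :
  bounded_measurable (fun psi : sphere R hd => sphere_vec psi a 0).
Proof.
have cE : continuous (fun psi : sphere_top R hd => sphere_vec (psi : sphere R hd) a 0).
  exact/continuous_entry/continuous_sphere_vec.
split.
- apply: (@continuous_measurable_borel _ (sphere_top R hd)) => U.
  by apply: continuous_comp; [exact: cE|exact: continuous_Re].
- apply: (@continuous_measurable_borel _ (sphere_top R hd)) => U.
  by apply: continuous_comp; [exact: cE|exact: continuous_Im].
- exists 1 => psi; apply: (@unit_vector_bound _ _ (fun a => sphere_vec psi a 0)).
  exact: sphere_vec_norm.
Qed.

(** The case [u = v], hence [kappa = 1], where both coefficients become
    [(d - 1) / (d (d^2 - 1))]. *)
Lemma sphere_moment4E (nu : probability (sphere R hd) R) (a c b e : 'I_d) :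
  unitarily_invariant nu ->
  moment4 nu (@sphere_vec R d hd) (@sphere_vec R d hd) a c b e =
  (d%:R * (d%:R + 1))^-1 *
    (((a == b) && (c == e))%:R + ((b == e) && (c == a))%:R).
Proof.
move=> hnu.
rewrite (@moment4E _ _ _ _ nu _ _ _ _ hd _ _ _ 1).
- have d1 : d%:R - 1 != 0 :> C by rewrite subr_eq0 pnatr_eq1 gtn_eqF.
  have d2 : d%:R + 1 != 0 :> C by rewrite natr1 pnatr_eq0.
  have d0 : d%:R != 0 :> C by rewrite pnatr_eq0 -lt0n ltnW.
  have d3 : d%:R ^+ 2 - 1 != 0 :> C by rewrite subr_sqr_1 mulf_neq0.
  rewrite normr1 expr1n mulr1 [RHS]mulrDr; congr (_ * _ + _ * _);
    by field; apply/and3P.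
- exact: bounded_measurable_sphere_vec.
- exact: bounded_measurable_sphere_vec.
- move=> V Vu a' c' b' e'.
  rewrite /moment4 -[RHS](Cint_invariant (@measurable_sphere_act V Vu) (hnu V Vu)).
    by [].
  by apply: bounded_measurable_mono; exact: bounded_measurable_sphere_vec.
- exact: sphere_vec_norm.
- exact: sphere_vec_norm.
- exact: sphere_vec_norm.
Qed.

End Sphere.

(** * Learning networks *)

Section Deltas.
Context {C : pzRingType} {n : nat}.

Lemma sum_mul_delta (F : 'I_n -> C) (k : 'I_n) :
  \sum_i F i * (i == k)%:R = F k.
Proof.
rewrite (bigD1 k)//= eqxx mulr1 big1 ?addr0// => i ik.
by rewrite (negbTE ik) mulr0.
Qed.

Lemma sum_delta_mul (F : 'I_n -> C) (k : 'I_n) :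
  \sum_i (i == k)%:R * F i = F k.
Proof.
rewrite (bigD1 k)//= eqxx mul1r big1 ?addr0// => i ik.
by rewrite (negbTE ik) mul0r.
Qed.

End Deltas.

Lemma sum_mxtens (C : nmodType) (m n : nat) (F : 'I_(m * n) -> C) :
  \sum_k F k = \sum_i \sum_j F (mxtens_index (i, j)).
Proof.
rewrite pair_big/= (reindex (@mxtens_index m n)).
  by apply: eq_bigr => -[i j].
exists (@mxtens_unindex m n) => x _; [exact: mxtens_indexK|exact: mxtens_unindexK].
Qed.

Lemma mxtens_index_eq (m n : nat) (i k : 'I_m) (j l : 'I_n) :
  (mxtens_index (i, j) == mxtens_index (k, l)) = (i == k) && (j == l).
Proof. by rewrite (can_eq (@mxtens_indexK m n)). Qed.

(** * Quadratic forms and positive semidefinite matrices *)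

Section Positivity.
Context {R : realType} {n : nat}.
Local Notation C := (cplx R).
Implicit Types (A B : 'M[C]_n) (v : 'cV[C]_n).

Lemma expectE v A : expect v A = \sum_k \sum_l (v k 0)^* * A k l * v l 0.
Proof.
rewrite /expect -mulmxA mxE; apply: eq_bigr => k _.
rewrite !mxE mulr_sumr; apply: eq_bigr => l _.
by rewrite mulrA.
Qed.

Lemma expectD v A B : expect v (A + B) = expect v A + expect v B.
Proof. by rewrite /expect mulmxDr mulmxDl mxE. Qed.

Lemma expectZ v c A : expect v (c *: A) = c * expect v A.
Proof. by rewrite /expect -scalemxAr -scalemxAl mxE. Qed.

Lemma expect_sum v (I : Type) (r : seq I) (F : I -> 'M[C]_n) :
  expect v (\sum_(i <- r) F i) = \sum_(i <- r) expect v (F i).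
Proof. by rewrite /expect mulmx_sumr mulmx_suml summxE. Qed.

Lemma expect_trmx v A : expect v A^T = expect (map_mx Num.conj v) A.
Proof.
rewrite !expectE exchange_big/=; apply: eq_bigr => k _; apply: eq_bigr => l _.
by rewrite !mxE conjCK; ring.
Qed.

Lemma expect_ket_comb A (I : finType) (c : I -> C) (k : I -> 'I_n) :
  expect (\sum_a c a *: ket (k a)) A =
  \sum_a \sum_b (c a)^* * A (k a) (k b) * c b.
Proof.
have E : (\sum_a c a *: ket (k a))^t* = \sum_a (c a)^* *: delta_mx 0 (k a) :> 'rV[C]_n.
  apply/rowP => j; rewrite !mxE !summxE rmorph_sum/=; apply: eq_bigr => a _.
  by rewrite !mxE rmorphM/= conjC_nat andbT.
rewrite /expect E !mulmx_suml summxE.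
apply: eq_bigr => a _; rewrite mulmx_sumr summxE; apply: eq_bigr => b _.
by rewrite -!scalemxAl -scalemxAr mxE mxE -rowE -colE !mxE mulrCA mulrC.
Qed.

(** The double sum is the form at the sum of the basis vectors [ket (k a)]; for [k a = idx3 a j a]
    this vector is [omega] placed at outcome [j]. *)
Lemma psd_sum_entries A (I : finType) (k : I -> 'I_n) : psd A ->
  0 <= \sum_a \sum_b A (k a) (k b).
Proof.
move=> /(_ (\sum_a 1 *: ket (k a))); rewrite expect_ket_comb.
by under eq_bigr do under eq_bigr do rewrite conjC1 mul1r mulr1.
Qed.

Lemma psd_diag A k : psd A -> 0 <= A k k.
Proof.
by move=> /(@psd_sum_entries _ 'I_1 (fun=> k)); rewrite !big_ord1.
Qed.

(** Summing the nonnegative values of the form at [ket (k b) - ket (k a)] over all pairs gives twice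
    the difference of the two sides. It serves to bound [<omega| A |omega>] by [d] times the
    trace. *)
Lemma psd_sum_entries_le A (I : finType) (k : I -> 'I_n) : psd A ->
  \sum_a \sum_b A (k a) (k b) <= #|I|%:R * \sum_a A (k a) (k a).
Proof.
move=> Apsd.
have pair_ge0 (a b : I) :
    0 <= A (k a) (k a) + A (k b) (k b) - (A (k a) (k b) + A (k b) (k a)).
  have := Apsd (\sum_(x : bool) (-1) ^+ x *: ket (if x then k a else k b)).
  rewrite expect_ket_comb !big_bool/= expr0 expr1 rmorphN !conjC1.
  by congr (0 <= _); ring.
have : 0 <= \sum_a \sum_b (A (k a) (k a) + A (k b) (k b)
      - (A (k a) (k b) + A (k b) (k a))).
  by apply: sumr_ge0 => a _; apply: sumr_ge0.
set S1 := \sum_a \sum_b A (k a) (k b); set S2 := \sum_a A (k a) (k a).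
suff -> : \sum_a \sum_b (A (k a) (k a) + A (k b) (k b)
      - (A (k a) (k b) + A (k b) (k a))) = (#|I|%:R * S2 - S1) *+ 2.
  by rewrite pmulrn_lge0// subr_ge0.
have E1 : \sum_(a : I) \sum_(b : I) A (k a) (k a) = #|I|%:R * S2.
  by rewrite mulr_sumr; apply: eq_bigr => a _; rewrite sumr_const mulr_natl.
have E2 : \sum_(a : I) \sum_(b : I) A (k b) (k b) = #|I|%:R * S2.
  by rewrite exchange_big.
have E3 : \sum_a \sum_b A (k b) (k a) = S1 by rewrite exchange_big.
under eq_bigr do rewrite sumrB !big_split/=.
by rewrite sumrB !big_split/= E1 E2 E3 -/S1; ring.
Qed.

End Positivity.

(** * Entries of networks and of replicated POVMs *)

Section Networks.
Context {R : realType} {d : nat}.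
Local Notation C := (cplx R).
Implicit Types (U : 'M[C]_d) (N : 'I_d -> 'M[C]_(d * d * d)).

Definition idx3 (x j a : 'I_d) : 'I_(d * d * d) :=
  mxtens_index (mxtens_index (x, j), a).

Lemma sum_idx3 (F : 'I_(d * d * d) -> C) :
  \sum_k F k = \sum_x \sum_j \sum_a F (idx3 x j a).
Proof. by rewrite sum_mxtens (sum_mxtens (fun k => \sum_j F _)). Qed.

Lemma insertionE U (j x k a y : 'I_d) :
  insertion U j (idx3 x k a) y =
  (x == y)%:R * (k == j)%:R * (U *m ket j) a 0.
Proof.
rewrite /insertion castmxE /=.
(* The cast identifies the column index set ['I_(d * 1 * 1)] with ['I_d], the two kets contributing
   trivial factors. *)
have -> : cast_ord (esym (etrans (muln1 (d * 1)) (muln1 d))) y =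
    mxtens_index (mxtens_index (y, 0 : 'I_1), 0 : 'I_1).
  by apply: val_inj => /=; rewrite !muln1 !addn0.
rewrite cast_ord_id !tensmxE !mxE eqxx andbT.
by [].
Qed.

Lemma sum_insertion U (j y : 'I_d) (F : 'I_(d * d * d) -> C) :
  \sum_k F k * insertion U j k y = \sum_a F (idx3 y j a) * (U *m ket j) a 0.
Proof.
rewrite sum_idx3 (bigD1 y)//= [X in _ + X]big1 ?addr0; last first.
  move=> x xy; apply: big1 => k _; apply: big1 => a _.
  by rewrite insertionE (negbTE xy) !mul0r mulr0.
rewrite (bigD1 j)//= [X in _ + X]big1 ?addr0; last first.
  move=> k kj; apply: big1 => a _.
  by rewrite insertionE (negbTE kj) mulr0 mul0r mulr0.
by apply: eq_bigr => a _; rewrite insertionE !eqxx !mul1r.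
Qed.

(** The transposition in the definition of the replicated POVM is what puts [x] on the row side of
    [N i] and [y] on its column side. *)
Lemma replicatedE N U (i y x : 'I_d) :
  replicated N U i y x =
  \sum_j \sum_a \sum_b ((U *m ket j) a 0)^* *
    N i (idx3 x j a) (idx3 y j b) * (U *m ket j) b 0.
Proof.
rewrite /replicated mxE summxE; apply: eq_bigr => j _.
rewrite mxE sum_insertion exchange_big/=; apply: eq_bigr => b _.
rewrite -mulr_suml; congr (_ * _); rewrite mxE.
(* Conjugating the bra side brings it into the form handled by [sum_insertion]. *)
transitivity ((\sum_k (N i k (idx3 y j b))^* * insertion U j k x)^*).
  rewrite rmorph_sum; apply: eq_bigr => k _.
  by rewrite rmorphM/= conjCK !mxE mulrC.
rewrite sum_insertion rmorph_sum; apply: eq_bigr => a _.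
by rewrite rmorphM/= conjCK mulrC.
Qed.

(** The transposition becomes a conjugation of [v], leaving values of the form of [N i]; positivity
    is thereby inherited. *)
Lemma replicated_expect N U (i : 'I_d) (v : 'cV[C]_d) :
  expect v (replicated N U i) =
  \sum_j expect (insertion U j *m map_mx Num.conj v) (N i).
Proof.
rewrite /replicated expect_trmx expect_sum; apply: eq_bigr => j _.
by rewrite /expect trmx_mul map_mxM !mulmxA.
Qed.

Lemma replicated_expect_ge0 N U (i : 'I_d) (v : 'cV[C]_d) :
  psd (N i) -> 0 <= expect v (replicated N U i).
Proof. by move=> Npsd; rewrite replicated_expect; apply: sumr_ge0. Qed.

Lemma unitary_ket_complete U (x y : 'I_d) : U \is unitarymx ->
  \sum_j (U *m ket j) x 0 * ((U *m ket j) y 0)^* = (x == y)%:R.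
Proof.
move=> /unitarymxP /(congr1 (fun M : 'M[C]_d => M x y)).
rewrite !mxE => <-; apply: eq_bigr => a _.
by rewrite -!colE !mxE.
Qed.

Lemma von_neumannE U (i x y : 'I_d) :
  von_neumann U i x y = (U *m ket i) x 0 * ((U *m ket i) y 0)^*.
Proof.
have -> : von_neumann U i = (U *m ket i) *m (U *m ket i)^t*.
  by rewrite /von_neumann /ketbra trmx_mul map_mxM !mulmxA.
by rewrite mxE big_ord1 !mxE.
Qed.

Section Learning.
Variable N : 'I_d -> 'M[C]_(d * d * d).
Variable rho : 'M[C]_d.
Hypothesis sumN : \sum_i N i = 1%:M *t 1%:M *t rho.
Hypothesis tr_rho : \tr rho = 1.

Lemma sum_networkE (x j a y k b : 'I_d) :
  \sum_i N i (idx3 x j a) (idx3 y k b) = (x == y)%:R * (j == k)%:R * rho a b.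
Proof.
rewrite -summxE sumN !tensmxE !mxE.
by [].
Qed.

(** Normalization turns the sum into the identity times [\sum_j <U j| rho |U j>], which is the trace
    of [rho] by completeness of the vectors [U |j>]. *)
Lemma sum_replicated U : U \is unitarymx -> \sum_i replicated N U i = 1%:M.
Proof.
move=> Uu; apply/matrixP => y x; rewrite summxE.
under eq_bigr do rewrite replicatedE.
rewrite exchange_big/=.
transitivity (\sum_j \sum_a \sum_b ((U *m ket j) a 0)^* *
  ((x == y)%:R * rho a b) * (U *m ket j) b 0).
  apply: eq_bigr => j _; rewrite exchange_big; apply: eq_bigr => a _.
  rewrite exchange_big; apply: eq_bigr => b _.
  by rewrite -mulr_suml -mulr_sumr sum_networkE eqxx mulr1.
transitivity ((x == y)%:R * \sum_a \sum_b rho a b *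
    \sum_j (U *m ket j) b 0 * ((U *m ket j) a 0)^*).
  rewrite exchange_big mulr_sumr; apply: eq_bigr => a _.
  rewrite exchange_big mulr_sumr; apply: eq_bigr => b _.
  rewrite !mulr_sumr; apply: eq_bigr => j _; ring.
under eq_bigr do under eq_bigr do rewrite unitary_ket_complete//.
under eq_bigr do rewrite sum_mul_delta.
by rewrite -/(\tr rho) tr_rho mulr1 mxE eq_sym.
Qed.

(** The diagonal block at outcome [j] of the summed network is [I (x) rho], with trace
    [d \tr rho]. *)
Lemma sum_network_trace j :
  \sum_i \sum_a \sum_b N i (idx3 a j b) (idx3 a j b) = d%:R.
Proof.
rewrite exchange_big/=; transitivity (\sum_(a < d) (1 : C)).
  apply: eq_bigr => a _; rewrite exchange_big/= -tr_rho; apply: eq_bigr => b _.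
  by rewrite sum_networkE !eqxx !mul1r.
by rewrite sumr_const card_ord.
Qed.

(** For the same block, [<omega| I (x) rho |omega> = \tr rho]. *)
Lemma sum_network_omega j :
  \sum_i \sum_a \sum_b N i (idx3 a j a) (idx3 b j b) = 1.
Proof.
rewrite exchange_big/= -tr_rho; apply: eq_bigr => a _.
rewrite exchange_big/= -(sum_mul_delta (rho a) a); apply: eq_bigr => b _.
by rewrite sum_networkE eqxx mulr1 eq_sym mulrC.
Qed.

End Learning.
End Networks.

(** * The optimal network *)

Section PositiveForms.
Context {R : realType} {n : nat}.
Local Notation C := (cplx R).

Lemma psdD (A B : 'M[C]_n) : psd A -> psd B -> psd (A + B).
Proof. by move=> Ap Bp v; rewrite expectD addr_ge0. Qed.

Lemma psdZ (c : C) (A : 'M[C]_n) : 0 <= c -> psd A -> psd (c *: A).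
Proof. by move=> c0 Ap v; rewrite expectZ mulr_ge0. Qed.

Lemma psd_gram (m : nat) (X : 'M[C]_(m, n)) : psd (X^t* *m X).
Proof.
move=> v; rewrite /expect mulmxA -mulmxA -map_mxM -trmx_mul mxE.
by apply: sumr_ge0 => k _; rewrite !mxE mulrC mul_conjC_ge0.
Qed.

Lemma psd_ketbra (v : 'cV[C]_n) : psd (ketbra v).
Proof. by rewrite /ketbra -{1}[v]trmxCK; exact: psd_gram. Qed.

End PositiveForms.

Section OptimalNetwork.
Context {R : realType} {d : nat}.
Local Notation C := (cplx R).
Local Notation idx3 := (@idx3 d).

Lemma idx3P (k : 'I_(d * d * d)) : exists x j a, k = idx3 x j a.
Proof.
exists (mxtens_unindex (mxtens_unindex k).1).1.
exists (mxtens_unindex (mxtens_unindex k).1).2.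
exists (mxtens_unindex k).2.
by rewrite /idx3 -!surjective_pairing !mxtens_unindexK.
Qed.

Lemma tens_1_20E (A : 'M[C]_d) (B : 'M[C]_(d * d)) x j a y k b :
  tens_1_20 A B (idx3 x j a) (idx3 y k b) =
  A j k * B (mxtens_index (x, a)) (mxtens_index (y, b)).
Proof. by rewrite mxE !mxtens_indexK. Qed.

(** A diagonal [A] makes the operator block diagonal over the outcome space, so its form at [w] is
    the sum of the forms of [B] at the slices of [w], weighted by [c]. *)
Lemma psd_tens_1_20 (c : 'I_d -> C) (A : 'M[C]_d) (B : 'M[C]_(d * d)) :
  (forall j k, A j k = (j == k)%:R * c j) -> (forall j, 0 <= c j) -> psd B ->
  psd (tens_1_20 A B).
Proof.
move=> AE c0 Bp w.
pose slice j : 'cV[C]_(d * d) :=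
  \col_k w (idx3 (mxtens_unindex k).1 j (mxtens_unindex k).2) 0.
suff -> : expect w (tens_1_20 A B) = \sum_j c j * expect (slice j) B.
  by apply: sumr_ge0 => j _; rewrite mulr_ge0.
rewrite expectE sum_idx3 exchange_big/=; apply: eq_bigr => j _.
rewrite expectE sum_mxtens mulr_sumr; apply: eq_bigr => x _.
rewrite mulr_sumr; apply: eq_bigr => a _.
rewrite sum_idx3 sum_mxtens mulr_sumr; apply: eq_bigr => y _.
rewrite exchange_big/= mulr_sumr; apply: eq_bigr => b _.
rewrite (bigD1 j)//= big1 ?addr0; last first.
  by move=> k kj; rewrite tens_1_20E AE eq_sym (negbTE kj) !mul0r mulr0 mul0r.
by rewrite tens_1_20E AE eqxx mul1r !mxE !mxtens_indexK/=; ring.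
Qed.

Lemma omegaE (x a : 'I_d) : (omega : 'cV[C]__) (mxtens_index (x, a)) 0 = (x == a)%:R.
Proof.
rewrite /omega summxE -(@sum_delta_mul C d (fun i => (i == a)%:R) x).
apply: eq_bigr => n _.
by rewrite mxE mxtens_indexK/= !ord1 !mxE !andbT eq_sym [a == n]eq_sym.
Qed.

Lemma PpE (x a y b : 'I_d) :
  (Pp : 'M[C]__) (mxtens_index (x, a)) (mxtens_index (y, b)) =
  d%:R^-1 * ((x == a)%:R * (y == b)%:R).
Proof.
by rewrite /Pp mxE /ketbra mxE big_ord1 !mxE !omegaE conjC_nat.
Qed.

Lemma PqE (x a y b : 'I_d) :
  (Pq : 'M[C]__) (mxtens_index (x, a)) (mxtens_index (y, b)) =
  (x == y)%:R * (a == b)%:R - d%:R^-1 * ((x == a)%:R * (y == b)%:R).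
Proof. by rewrite /Pq mxE mxE [X in _ + X]mxE PpE mxtens_index_eq -mulnb natrM. Qed.

Lemma psd_Pp : psd (Pp : 'M[C]_(d * d)).
Proof. by apply: psdZ; [rewrite invr_ge0 ler0n|exact: psd_ketbra]. Qed.

Lemma omega_norm : (omega : 'cV[C]_(d * d))^t* *m omega = d%:R%:M.
Proof.
apply/matrixP => i j; rewrite !ord1 !mxE eqxx mulr1n.
rewrite sum_mxtens; transitivity (\sum_(x < d) (1 : C)); last first.
  by rewrite sumr_const card_ord.
apply: eq_bigr => x _.
under eq_bigr => a _ do rewrite !mxE omegaE conjC_nat eq_sym.
by rewrite sum_mul_delta eqxx.
Qed.

(** [Pq] is an orthogonal projection, so it equals [Pq^t* *m Pq], a Gram matrix. *)
Lemma psd_Pq : (0 < d)%N -> psd (Pq : 'M[C]_(d * d)).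
Proof.
move=> d0; have dn0 : d%:R != 0 :> C by rewrite pnatr_eq0 -lt0n.
have PpPp : Pp *m Pp = Pp :> 'M[C]_(d * d).
  rewrite /Pp /ketbra -scalemxAl -scalemxAr scalerA.
  rewrite -mulmxA (mulmxA _ omega) omega_norm mul_scalar_mx -scalemxAr scalerA.
  by rewrite mulfVK.
have PqPq : Pq *m Pq = Pq :> 'M[C]_(d * d).
  by rewrite /Pq mulmxBl mul1mx mulmxBr mulmx1 PpPp subrr subr0.
have PqC : Pq^t* = Pq :> 'M[C]_(d * d).
  rewrite /Pq /Pp /ketbra linearB/= map_mxB trmx1 map_mx1 linearZ/= map_mxZ/=.
  by rewrite trmx_mul map_mxM trmxCK fmorphV/= conjC_nat.
by rewrite -PqPq -{1}PqC; exact: psd_gram.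
Qed.

Lemma ketbra_ketE (i j k : 'I_d) :
  (ketbra (ket i) : 'M[C]_d) j k = (j == k)%:R * (j == i)%:R.
Proof.
rewrite /ketbra mxE big_ord1 !mxE conjC_nat !andbT -!natrM !mulnb.
by have [->|] := eqVneq j i; rewrite ?andbF// eq_sym andbT.
Qed.

Lemma ketbraC_ketE (i j k : 'I_d) :
  (1%:M - ketbra (ket i) : 'M[C]_d) j k = (j == k)%:R * (1 - (j == i)%:R).
Proof. by rewrite mxE mxE [X in _ + X]mxE ketbra_ketE mulrBr mulr1. Qed.

Lemma opt_networkE (i x j a y k b : 'I_d) :
  (opt_network i : 'M[C]__) (idx3 x j a) (idx3 y k b) =
  (j == k)%:R * ((j == i)%:R * (d%:R^-1 * (Pp : 'M[C]__) (mxtens_index (x, a)) (mxtens_index (y, b)))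
   + (1 - (j == i)%:R) * ((d%:R * (d%:R - 1))^-1 *
      (Pq : 'M[C]__) (mxtens_index (x, a)) (mxtens_index (y, b)))).
Proof.
rewrite /opt_network mxE [X in X + _]tens_1_20E [X in _ + X = _]tens_1_20E.
rewrite ketbra_ketE ketbraC_ketE.
by rewrite [(_ *: Pp) _ _]mxE [(_ *: Pq) _ _]mxE; ring.
Qed.

Lemma opt_network_learning : (1 < d)%N -> learning_network (@opt_network R d).
Proof.
move=> hd.
have dn0 : d%:R != 0 :> C by rewrite pnatr_eq0 -lt0n ltnW.
have d1 : d%:R - 1 != 0 :> C by rewrite subr_eq0 pnatr_eq1 gtn_eqF.
have d1p : 0 <= d%:R - 1 :> C by rewrite subr_ge0 ler1n ltnW.
split.
  move=> i; apply: psdD.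
    apply: (@psd_tens_1_20 (fun j => (j == i)%:R)) => [j k|j|].
    - exact: ketbra_ketE.
    - exact: ler0n.
    - by apply: psdZ; [rewrite invr_ge0 ler0n|exact: psd_Pp].
  apply: (@psd_tens_1_20 (fun j => 1 - (j == i)%:R)) => [j k|j|].
  - exact: ketbraC_ketE.
  - by case: (j == i); rewrite ?subrr ?subr0.
  - apply: psdZ; last exact/psd_Pq/ltnW.
    by rewrite invr_ge0 mulr_ge0// ler0n.
(* The state is maximally mixed: at each outcome, [Pp / d] occurs once and [Pq / (d (d - 1))] occurs
   [d - 1] times, with total [I / d]. *)
exists (d%:R^-1)%:M; split.
- move=> v; rewrite -scalemx1 expectZ mulr_ge0 ?invr_ge0 ?ler0n//.
  rewrite /expect mulmx1 mxE; apply: sumr_ge0 => k _.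
  by rewrite !mxE mulrC mul_conjC_ge0.
- by rewrite mxtrace_scalar -[LHS]mulr_natr mulVf.
- apply/matrixP => k l; rewrite summxE.
  have [x [j [a ->]]] := idx3P k; have [y [j' [b ->]]] := idx3P l.
  rewrite !tensmxE; under eq_bigr do rewrite opt_networkE.
  rewrite -mulr_sumr big_split/= -!mulr_suml.
  have S1 : \sum_i (j == i)%:R = 1 :> C.
    by under eq_bigr do rewrite eq_sym -[_%:R]mul1r; rewrite sum_mul_delta.
  rewrite sumrB S1 sumr_const card_ord PqE PpE !mxE.
  rewrite -[_ *+ (a == b)]mulr_natr; field.
  by apply/andP.
Qed.

(** With [E_j] the projector on [U |j>], the form of [Pp] at outcome [j] yields [E_j / d] and that
    of [Pq] yields [I - E_j / d]. The result follows by summing over [j] with [\sum_j E_j = I]. *)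
Lemma replicated_opt (U : 'M[C]_d) (i : 'I_d) : (1 < d)%N -> U \is unitarymx ->
  replicated opt_network U i =
    (d%:R * (d%:R - 1))^-1 *: (U *m ketbra (ket i) *m U^t*) +
    ((d%:R ^+ 2 - d%:R - 1) / (d%:R ^+ 2 * (d%:R - 1))) *: 1%:M.
Proof.
move=> hd Uu.
have dn0 : d%:R != 0 :> C by rewrite pnatr_eq0 -lt0n ltnW.
have d1 : d%:R - 1 != 0 :> C by rewrite subr_eq0 pnatr_eq1 gtn_eqF.
apply/matrixP => y x; rewrite replicatedE.
pose u j a := (U *m ket j) a 0.
have quadPp j : \sum_a \sum_b (u j a)^* * ((x == a)%:R * (y == b)%:R) * u j b =
    (u j x)^* * u j y.
  transitivity (\sum_a (u j a)^* * (a == x)%:R * u j y); last first.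
    by rewrite -mulr_suml sum_mul_delta.
  apply: eq_bigr => a _.
  rewrite -[u j y](@sum_delta_mul C d (u j) y) mulr_sumr.
  by apply: eq_bigr => b _; rewrite eq_sym [y == b]eq_sym; ring.
have quadPq j : \sum_a \sum_b (u j a)^* * ((x == y)%:R * (a == b)%:R) * u j b =
    (x == y)%:R.
  transitivity ((x == y)%:R * \sum_a (u j a)^* * u j a); last first.
    by rewrite unitary_ket_ip// eqxx mulr1.
  rewrite mulr_sumr; apply: eq_bigr => a _.
  rewrite -(@sum_delta_mul C d (u j) a) !mulr_sumr.
  by apply: eq_bigr => b _; rewrite [a == b]eq_sym; ring.
pose s : C := (d%:R * (d%:R - 1))^-1.
transitivity (\sum_j ((j == i)%:R * (d%:R^-1 * d%:R^-1 * ((u j x)^* * u j y)) +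
    (1 - (j == i)%:R) * (s * ((x == y)%:R - d%:R^-1 * ((u j x)^* * u j y))))).
  apply: eq_bigr => j _; rewrite -[in RHS](quadPq j) -!quadPp.
  rewrite !mulr_sumr -!sumrB !mulr_sumr -big_split/=; apply: eq_bigr => a _.
  rewrite !mulr_sumr -!sumrB !mulr_sumr -big_split/=; apply: eq_bigr => b _.
  by rewrite opt_networkE PpE PqE eqxx -/s /u mulr1n; ring.
(* The [Pq] contribution is completed to all [j] and corrected at [j = i], so that completeness
   applies to a full sum. *)
rewrite (eq_bigr (fun j => (j == i)%:R * (d%:R^-1 * d%:R^-1 * ((u j x)^* * u j y)
    - s * ((x == y)%:R - d%:R^-1 * ((u j x)^* * u j y)))
    + s * ((x == y)%:R - d%:R^-1 * ((u j x)^* * u j y)))); last first.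
  by move=> j _; ring.
rewrite big_split/= sum_delta_mul -mulr_sumr sumrB sumr_const card_ord -mulr_sumr.
have -> : \sum_j (u j x)^* * u j y = (x == y)%:R.
  rewrite eq_sym -(unitary_ket_complete y x Uu).
  by apply: eq_bigr => j _; rewrite mulrC.
have -> : U *m ketbra (ket i) *m U^t* = von_neumann U i by [].
rewrite mxE [(_ *: von_neumann U i) y x]mxE von_neumannE -/(u i y) -/(u i x).
rewrite [(_ *: 1%:M) y x]mxE [1%:M y x]mxE [y == x]eq_sym /s.
rewrite -[_ *+ d]mulr_natr; field.
by apply/andP.
Qed.

Lemma replicated_opt_diag (i : 'I_d) : (1 < d)%N ->
  expect (ket i) (replicated opt_network 1%:M i) = (d%:R + 1) / d%:R ^+ 2 :> C.
Proof.
move=> hd.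
have dn0 : d%:R != 0 :> C by rewrite pnatr_eq0 -lt0n ltnW.
have d1 : d%:R - 1 != 0 :> C by rewrite subr_eq0 pnatr_eq1 gtn_eqF.
have U1 : (1%:M : 'M[C]_d) \is unitarymx.
  by apply/unitarymxP; rewrite trmx1 map_mx1 mulmx1.
rewrite replicated_opt// trmx1 map_mx1 mulmx1 mul1mx.
have -> A : expect (ket i) A = A i i :> C.
  have := @expect_ket_comb R d A 'I_1 (fun=> 1) (fun=> i).
  by rewrite !big_ord1 scale1r conjC1 mul1r mulr1.
rewrite mxE [(_ *: ketbra _) _ _]mxE [(_ *: 1%:M) _ _]mxE ketbra_ketE !mxE !eqxx.
rewrite !mulr1; field.
by apply/andP.
Qed.

End OptimalNetwork.

(** * The figure of merit *)

Section SphereAverage.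
Context {R : realType} {d : nat}.
Local Notation C := (cplx R).
Implicit Types (H : 'M[C]_d).

(** Closed form of the spherical average of [|<psi| H |psi>|^2]. The double sum is the squared
    Hilbert-Schmidt norm. *)
Definition sphere_avg_sq H : C := (d%:R * (d%:R + 1))^-1 *
  (\sum_a \sum_b H a b * (H a b)^* + \tr H * (\tr H)^*).

Lemma expect_sqE (v : 'cV[C]_d) H : `|expect v H| ^+ 2 =
  \sum_a \sum_b \sum_c \sum_e (H a b * (H c e)^*) *
    ((v a 0)^* * v c 0 * v b 0 * (v e 0)^*).
Proof.
rewrite normCK expectE rmorph_sum/= big_distrl/=; apply: eq_bigr => a _.
rewrite big_distrl/=; apply: eq_bigr => b _.
rewrite big_distrr/=; apply: eq_bigr => c _.
rewrite rmorph_sum big_distrr/=; apply: eq_bigr => e _.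
rewrite !rmorphM/= conjCK; ring.
Qed.

Lemma sum_delta4 H : \sum_a \sum_b \sum_c \sum_e (H a b * (H c e)^*) *
    (((a == b) && (c == e))%:R + ((b == e) && (c == a))%:R) =
  \sum_a \sum_b H a b * (H a b)^* + \tr H * (\tr H)^* :> C.
Proof.
have E1 : \sum_a \sum_b \sum_c \sum_e
    (H a b * (H c e)^*) * ((a == b) && (c == e))%:R = \tr H * (\tr H)^*.
  rewrite [in RHS]/mxtrace big_distrl/=; apply: eq_bigr => a _.
  rewrite -[RHS](@sum_delta_mul C d (fun b => H a b * (\tr H)^*) a).
  apply: eq_bigr => b _; rewrite [in RHS]/mxtrace rmorph_sum !mulr_sumr/=.
  apply: eq_bigr => c _.
  rewrite -(@sum_delta_mul C d (fun e => (H c e)^*) c) !mulr_sumr.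
  by apply: eq_bigr => e _; rewrite -mulnb natrM eq_sym [c == e]eq_sym; ring.
have E2 : \sum_a \sum_b \sum_c \sum_e
    (H a b * (H c e)^*) * ((b == e) && (c == a))%:R =
    \sum_a \sum_b H a b * (H a b)^*.
  apply: eq_bigr => a _; apply: eq_bigr => b _.
  rewrite -(@sum_delta_mul C d (fun c => (H c b)^*) a) mulr_sumr.
  apply: eq_bigr => c _.
  rewrite -(@sum_delta_mul C d (fun e => (H c e)^*) b) !mulr_sumr.
  by apply: eq_bigr => e _; rewrite -mulnb natrM [b == e]eq_sym; ring.
rewrite -E1 -E2 -big_split/=; apply: eq_bigr => a _.
rewrite -big_split/=; apply: eq_bigr => b _.
rewrite -big_split/=; apply: eq_bigr => c _.
rewrite -big_split/=; apply: eq_bigr => e _.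
by rewrite mulrDr addrC.
Qed.

Variables (hd : (1 < d)%N) (nu : probability (sphere R hd) R).

Let mono_bounded (a c b e : 'I_d) : bounded_measurable (fun psi : sphere R hd =>
  (sphere_vec psi a 0)^* * sphere_vec psi c 0 * sphere_vec psi b 0 *
  (sphere_vec psi e 0)^*).
Proof. by apply: bounded_measurable_mono; exact: bounded_measurable_sphere_vec. Qed.

Lemma bounded_measurable_expect_sq H : bounded_measurable
  (fun psi : sphere R hd => `|expect (sphere_vec psi) H| ^+ 2).
Proof.
under eq_fun do rewrite expect_sqE.
do 4! apply: bounded_measurable_sum => ?.
by apply: bounded_measurableM => //; exact: bounded_measurable_cst.
Qed.

Lemma Cint_expect_sq H : unitarily_invariant nu ->
  Cint nu (fun psi => `|expect (sphere_vec psi) H| ^+ 2) = sphere_avg_sq H.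
Proof.
move=> hnu; under eq_fun do rewrite expect_sqE.
have cB a b c e : bounded_measurable (fun psi : sphere R hd =>
    (H a b * (H c e)^*) *
    ((sphere_vec psi a 0)^* * sphere_vec psi c 0 * sphere_vec psi b 0 *
    (sphere_vec psi e 0)^*)).
  by apply: bounded_measurableM => //; exact: bounded_measurable_cst.
rewrite /sphere_avg_sq -sum_delta4 mulr_sumr Cint_sum; last first.
  by move=> ?; do 3! apply: bounded_measurable_sum => ?.
apply: eq_bigr => a _; rewrite mulr_sumr Cint_sum; last first.
  by move=> ?; do 2! apply: bounded_measurable_sum => ?.
apply: eq_bigr => b _; rewrite mulr_sumr Cint_sum; last first.
  by move=> ?; apply: bounded_measurable_sum => ?.
apply: eq_bigr => c _; rewrite mulr_sumr Cint_sum//.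
apply: eq_bigr => e _; rewrite CintZ//.
have := sphere_moment4E a c b e hnu; rewrite /moment4 => ->; ring.
Qed.

End SphereAverage.

(** * The figure of merit as a single Haar average *)

Section Merit.
Context {R : realType} {d : nat} (hd : (1 < d)%N).
Local Notation C := (cplx R).
Variables (mu : probability (SU R d) R) (nu : probability (sphere R hd) R).
Hypotheses (hmu : is_haar mu) (hnu : unitarily_invariant nu).
Implicit Types (N : 'I_d -> 'M[C]_(d * d * d)) (U : SU R d).

Definition povm_error N (U : 'M[C]_d) i := von_neumann U i - replicated N U i.

Lemma bounded_measurable_replicated N i y x :
  bounded_measurable (fun U => replicated N (SUmx U) i y x).
Proof.
under eq_fun do rewrite replicatedE.
do 3! apply: bounded_measurable_sum => ?.
apply: bounded_measurableM; last exact: bounded_measurable_SU_ket.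
apply: bounded_measurableM; last exact: bounded_measurable_cst.
exact/bounded_measurable_conj/bounded_measurable_SU_ket.
Qed.

Lemma bounded_measurable_povm_error N i y x :
  bounded_measurable (fun U => povm_error N (SUmx U) i y x).
Proof.
rewrite (_ : (fun _ => _) = fun U => (SUmx U *m ket i) y 0 *
  ((SUmx U *m ket i) x 0)^* + (-1) * replicated N (SUmx U) i y x); last first.
  by apply/funext => U; rewrite mxE von_neumannE [X in _ + X = _]mxE mulN1r.
apply: bounded_measurableD; apply: bounded_measurableM.
- exact: bounded_measurable_SU_ket.
- exact/bounded_measurable_conj/bounded_measurable_SU_ket.
- exact: bounded_measurable_cst.
- exact: bounded_measurable_replicated.
Qed.

Lemma bounded_measurable_merit N : bounded_measurable
  (fun U => \sum_i sphere_avg_sq (povm_error N (SUmx U) i)).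
Proof.
apply: bounded_measurable_sum => i.
apply: bounded_measurableM; first exact: bounded_measurable_cst.
apply: bounded_measurableD.
  do 2! apply: bounded_measurable_sum => ?.
  apply: bounded_measurableM; first exact: bounded_measurable_povm_error.
  exact/bounded_measurable_conj/bounded_measurable_povm_error.
have trB : bounded_measurable (fun U => \tr (povm_error N (SUmx U) i)).
  by apply: bounded_measurable_sum => ?; exact: bounded_measurable_povm_error.
by apply: bounded_measurableM => //; exact: bounded_measurable_conj.
Qed.

Lemma Re_sum (I : Type) (r : seq I) (F : I -> C) :
  complex.Re (\sum_(i <- r) F i) = \sum_(i <- r) complex.Re (F i).
Proof. by elim/big_rec2: _ => // i y1 y2 _ <-; rewrite ReD. Qed.

Lemma figure_of_meritE N : figure_of_merit mu nu N =
  (complex.Re (Cint mu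
    (fun U => \sum_i sphere_avg_sq (povm_error N (SUmx U) i))))%:E.
Proof.
rewrite -integral_Re; last exact: bounded_measurable_merit.
apply: eq_integral => U _.
transitivity (\int[nu]_psi (complex.Re (\sum_i
    (`|expect (sphere_vec psi) (povm_error N (SUmx U) i)| ^+ 2 : C)))%:E)%E.
  by apply: eq_integral => psi _; rewrite Re_sum.
rewrite integral_Re; last first.
  by apply: bounded_measurable_sum => i; exact: bounded_measurable_expect_sq.
rewrite Cint_sum; last by move=> i; exact: bounded_measurable_expect_sq.
by under eq_bigr do rewrite Cint_expect_sq//.
Qed.

End Merit.

(** * The lower bound *)

Section Deviation.
Context {R : realType} {d : nat}.
Local Notation C := (cplx R).
Implicit Types (U H K : 'M[C]_d).

(** The traceless part of the projector, which is the direction of the error at the optimum. *)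
Definition centered_vn U i : 'M[C]_d := von_neumann U i - d%:R^-1 *: 1%:M.

Lemma hs_centered_vn U i H : \sum_a \sum_b H a b * (centered_vn U i a b)^* =
  expect (U *m ket i) H - d%:R^-1 * \tr H.
Proof.
rewrite expectE /mxtrace mulr_sumr -sumrB; apply: eq_bigr => a _.
rewrite -[X in _ - X](@sum_delta_mul C d (fun b => d%:R^-1 * H a b) a) -sumrB.
apply: eq_bigr => b _.
rewrite mxE von_neumannE [X in _ + X]mxE [X in - X]mxE [1%:M a b]mxE.
rewrite rmorphB !rmorphM/= fmorphV/= !conjC_nat conjCK [a == b]eq_sym; ring.
Qed.

Lemma expect1 (v : 'cV[C]_d) : expect v 1%:M = \sum_a (v a 0)^* * v a 0.
Proof. by rewrite /expect mulmx1 mxE; apply: eq_bigr => a _; rewrite !mxE. Qed.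

Lemma expect_ket_vn U i : U \is unitarymx ->
  expect (U *m ket i) (von_neumann U i) = 1.
Proof.
move=> Uu; rewrite expectE.
transitivity ((\sum_a ((U *m ket i) a 0)^* * (U *m ket i) a 0) *
  \sum_a ((U *m ket i) a 0)^* * (U *m ket i) a 0).
  rewrite big_distrl/=; apply: eq_bigr => a _.
  rewrite big_distrr/=; apply: eq_bigr => b _; rewrite von_neumannE; ring.
by rewrite unitary_ket_ip// eqxx mulr1.
Qed.

Lemma tr_vn U i : U \is unitarymx -> \tr (von_neumann U i) = 1.
Proof.
move=> Uu; transitivity (((i == i)%:R) : C); last by rewrite eqxx.
rewrite -(unitary_ket_ip i i Uu); apply: eq_bigr => a _.
by rewrite von_neumannE mulrC.
Qed.

Lemma sum_vn U : U \is unitarymx -> \sum_i von_neumann U i = 1%:M.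
Proof.
move=> Uu; apply/matrixP => x y; rewrite summxE mxE -(unitary_ket_complete x y Uu).
by apply: eq_bigr => i _; rewrite von_neumannE.
Qed.

Hypothesis d0 : (0 < d)%N.
Let dn0 : d%:R != 0 :> C. Proof. by rewrite pnatr_eq0 -lt0n. Qed.

Lemma tr_centered_vn U i : U \is unitarymx -> \tr (centered_vn U i) = 0.
Proof.
move=> Uu; rewrite /centered_vn linearB/= linearZ/= mxtrace1 tr_vn//.
by rewrite mulVf ?subrr.
Qed.

Lemma hs_centered_vn_sq U i : U \is unitarymx ->
  \sum_a \sum_b centered_vn U i a b * (centered_vn U i a b)^* = 1 - d%:R^-1.
Proof.
move=> Uu; rewrite hs_centered_vn tr_centered_vn// mulr0 subr0.
rewrite /centered_vn -scaleN1r expectD !expectZ expect_ket_vn//.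
rewrite expect1 unitary_ket_ip// eqxx.
by rewrite mulr1 mulN1r.
Qed.

Lemma sphere_avg_sq_centered U i (t : C) : U \is unitarymx -> t^* = t ->
  sphere_avg_sq (t *: centered_vn U i) =
  (d%:R * (d%:R + 1))^-1 * (t ^+ 2 * (1 - d%:R^-1)).
Proof.
move=> Uu tr; rewrite /sphere_avg_sq linearZ/= tr_centered_vn// mulr0 mul0r addr0.
congr (_ * _); rewrite -(hs_centered_vn_sq i Uu) mulr_sumr; apply: eq_bigr => a _.
rewrite mulr_sumr; apply: eq_bigr => b _; rewrite mxE rmorphM/= tr; ring.
Qed.

(* Tangent bound for the convex quadratic form at [t *: centered_vn U i]. *)
Lemma sphere_avg_sq_ge U i H (t : C) : U \is unitarymx -> t^* = t ->
  (d%:R * (d%:R + 1))^-1 *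
    (t * ((expect (U *m ket i) H - d%:R^-1 * \tr H) +
          (expect (U *m ket i) H - d%:R^-1 * \tr H)^*)
     - t ^+ 2 * (1 - d%:R^-1)) <= sphere_avg_sq H.
Proof.
move=> Uu tr; apply: ler_wpM2l.
  by rewrite invr_ge0 mulr_ge0 ?addr_ge0 ?ler0n ?ler01.
(* Dropping the trace term keeps the bound tight at the tangent point, where the trace is zero. *)
apply: (@le_trans _ _ (\sum_a \sum_b H a b * (H a b)^*)); last first.
  by rewrite lerDl mul_conjC_ge0.
rewrite -subr_ge0 -hs_centered_vn -(hs_centered_vn_sq i Uu).
set K := centered_vn U i.
(* The gap is the squared Hilbert-Schmidt norm of [H - t K]. *)
suff -> : \sum_a \sum_b H a b * (H a b)^* -
   (t * (\sum_a \sum_b H a b * (K a b)^* + (\sum_a \sum_b H a b * (K a b)^*)^*) -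
     t ^+ 2 * \sum_a \sum_b K a b * (K a b)^*) =
   \sum_a \sum_b (H a b - t * K a b) * (H a b - t * K a b)^*.
  by apply: sumr_ge0 => a _; apply: sumr_ge0 => b _; exact: mul_conjC_ge0.
rewrite rmorph_sum -big_split/= !mulr_sumr -!sumrB; apply: eq_bigr => a _.
rewrite rmorph_sum -big_split/= !mulr_sumr -!sumrB; apply: eq_bigr => b _.
rewrite !(rmorphB, rmorphM)/= conjCK tr; ring.
Qed.

(** The tangent bounds are added over [i]. Both POVMs sum to the identity, so the trace terms
    cancel; the fidelity sum is real, so the conjugate pairs combine into the factor 2. *)
Lemma sum_sphere_avg_sq_ge N U (t : C) :
  learning_network N -> U \is unitarymx -> t^* = t ->
  (d%:R * (d%:R + 1))^-1 *
    (2 * t * (d%:R - \sum_i expect (U *m ket i) (replicated N U i))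
     - t ^+ 2 * (d%:R - 1)) <= \sum_i sphere_avg_sq (povm_error N U i).
Proof.
move=> [Npsd [rho [rhopsd trrho sumN]]] Uu tr.
pose z i := expect (U *m ket i) (povm_error N U i) - d%:R^-1 * \tr (povm_error N U i).
set g := \sum_i expect _ (replicated _ _ _).
have gr : g^* = g.
  by apply: geC0_conj; apply: sumr_ge0 => i _; exact: replicated_expect_ge0.
have zE : \sum_i z i = d%:R - g.
  rewrite sumrB -mulr_sumr -raddf_sum/=.
  have -> : \sum_i povm_error N U i = 0.
    by rewrite sumrB sum_vn// (sum_replicated sumN trrho)// subrr.
  rewrite raddf0 mulr0 subr0.
  transitivity (\sum_(i < d) (1 - expect (U *m ket i) (replicated N U i))).
    apply: eq_bigr => i _; rewrite /povm_error -scaleN1r expectD expectZ.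
    by rewrite expect_ket_vn// mulN1r.
  by rewrite sumrB sumr_const card_ord.
apply: le_trans (_ : \sum_i (d%:R * (d%:R + 1))^-1 *
    (t * (z i + (z i)^*) - t ^+ 2 * (1 - d%:R^-1)) <= _); last first.
  by apply: ler_sum => i _; exact: sphere_avg_sq_ge.
rewrite -mulr_sumr sumrB -mulr_sumr big_split/= -rmorph_sum/= zE.
rewrite rmorphB/= conjC_nat gr sumr_const card_ord.
rewrite le_eqVlt; apply/orP; left; apply/eqP; congr (_ * _); rewrite -[_ *+ d]mulr_natr.
by field.
Qed.

End Deviation.

(** * Upper bound on the Haar-averaged fidelity *)

Section HaarFidelity.
Context {R : realType} {d : nat} (hd : (1 < d)%N).
Local Notation C := (cplx R).
Variable mu : probability (SU R d) R.
Hypothesis hmu : is_haar mu.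
Variable N : 'I_d -> 'M[C]_(d * d * d).

Let s : C := d%:R * (d%:R ^+ 2 - 1).
Let tN i j : C := \sum_a \sum_e N i (idx3 a j e) (idx3 a j e).
Let oN i j : C := \sum_a \sum_b N i (idx3 a j a) (idx3 b j b).

Lemma expect_replicatedE (U : 'M[C]_d) i :
  expect (U *m ket i) (replicated N U i) =
  \sum_j \sum_a \sum_f \sum_b \sum_e N i (idx3 b j e) (idx3 a j f) *
    (((U *m ket i) a 0)^* * (U *m ket j) f 0 * (U *m ket i) b 0 *
     ((U *m ket j) e 0)^*).
Proof.
rewrite expectE exchange_big/=.
transitivity (\sum_a \sum_b \sum_j \sum_f \sum_e N i (idx3 b j e) (idx3 a j f) *
    (((U *m ket i) a 0)^* * (U *m ket j) f 0 * (U *m ket i) b 0 *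
     ((U *m ket j) e 0)^*)).
  rewrite exchange_big/=; apply: eq_bigr => a _; apply: eq_bigr => b _.
  rewrite replicatedE mulr_sumr mulr_suml; apply: eq_bigr => j _.
  rewrite [RHS]exchange_big mulr_sumr mulr_suml; apply: eq_bigr => e _.
  rewrite mulr_sumr mulr_suml; apply: eq_bigr => f _; ring.
rewrite [RHS]exchange_big; apply: eq_bigr => a _.
rewrite [LHS]exchange_big; apply: eq_bigr => j _.
exact: exchange_big.
Qed.

Let mono_bounded i j (a f b e : 'I_d) : bounded_measurable (fun U : SU R d =>
  N i (idx3 b j e) (idx3 a j f) *
    (((SUmx U *m ket i) a 0)^* * (SUmx U *m ket j) f 0 * (SUmx U *m ket i) b 0 *
     ((SUmx U *m ket j) e 0)^*)).
Proof.
apply: bounded_measurableM; first exact: bounded_measurable_cst.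
by apply: bounded_measurable_mono; exact: bounded_measurable_SU_ket.
Qed.

Lemma bounded_measurable_fidelity i : bounded_measurable
  (fun U : SU R d => expect (SUmx U *m ket i) (replicated N (SUmx U) i)).
Proof.
under eq_fun do rewrite expect_replicatedE.
by do 5! apply: bounded_measurable_sum => ?.
Qed.

(** Columns [i] and [j] of a unitary have inner product [(i == j)%:R], which fixes the two moment
    coefficients. The first index pairing contracts the block of [N i] to its trace, the second to
    its value at [omega]. *)
Lemma Cint_fidelity i :
  Cint mu (fun U => expect (SUmx U *m ket i) (replicated N (SUmx U) i)) =
  \sum_j ((d%:R - (i == j)%:R) / s * tN i j + (d%:R * (i == j)%:R - 1) / s * oN i j).
Proof.
under eq_fun do rewrite expect_replicatedE.
rewrite Cint_sum; last by move=> j; do 4! apply: bounded_measurable_sum => ?.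
apply: eq_bigr => j _.
set B := _ / s; set G := _ / s.
transitivity (\sum_a \sum_f \sum_b \sum_e N i (idx3 b j e) (idx3 a j f) *
   (B * ((a == b) && (f == e))%:R + G * ((b == e) && (f == a))%:R)).
  rewrite Cint_sum; last by move=> ?; do 3! apply: bounded_measurable_sum => ?.
  apply: eq_bigr => a _.
  rewrite Cint_sum; last by move=> ?; do 2! apply: bounded_measurable_sum => ?.
  apply: eq_bigr => f _.
  rewrite Cint_sum; last by move=> ?; apply: bounded_measurable_sum => ?.
  apply: eq_bigr => b _; rewrite Cint_sum//; apply: eq_bigr => e _.
  rewrite CintZ; last by apply: bounded_measurable_mono; exact: bounded_measurable_SU_ket.
  by have := haar_moment4E hd i j a f b e hmu; rewrite /moment4 => ->.
have E1 : \sum_a \sum_f \sum_b \sum_e N i (idx3 b j e) (idx3 a j f) *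
   (B * ((a == b) && (f == e))%:R) = B * tN i j.
  rewrite mulr_sumr; apply: eq_bigr => a _; rewrite mulr_sumr; apply: eq_bigr => f _.
  rewrite -(@sum_delta_mul C d (fun b => N i (idx3 b j f) (idx3 a j f)) a) mulr_sumr.
  apply: eq_bigr => b _.
  rewrite -(@sum_delta_mul C d (fun e => N i (idx3 b j e) (idx3 a j f)) f) !mulr_sumr.
  by apply: eq_bigr => e _; rewrite -mulnb natrM eq_sym [f == e]eq_sym; ring.
have E2 : \sum_a \sum_f \sum_b \sum_e N i (idx3 b j e) (idx3 a j f) *
   (G * ((b == e) && (f == a))%:R) = G * oN i j.
  rewrite /oN [in RHS]exchange_big mulr_sumr; apply: eq_bigr => a _.
  rewrite -(@sum_delta_mul C d (fun f => G * \sum_b N i (idx3 b j b) (idx3 a j f)) a).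
  apply: eq_bigr => f _; rewrite !mulr_sumr; apply: eq_bigr => b _.
  rewrite -(@sum_delta_mul C d (fun e => N i (idx3 b j e) (idx3 a j f)) b) !mulr_sumr.
  by apply: eq_bigr => e _; rewrite -mulnb natrM [b == e]eq_sym; ring.
rewrite -E1 -E2 -big_split/=; apply: eq_bigr => a _.
rewrite -big_split/=; apply: eq_bigr => f _.
rewrite -big_split/=; apply: eq_bigr => b _.
rewrite -big_split/=; apply: eq_bigr => e _.
by rewrite mulrDr.
Qed.

(** Each outcome [j] is bounded separately. Its contribution is [(d^2 - 1 - t_jj + d o_jj) / s];
    with [o_jj <= d t_jj] and then [o_jj <= 1], it is at most [(d + 1) / d^2]. *)
Lemma Cint_fidelity_le : learning_network N ->
  \sum_i Cint mu (fun U => expect (SUmx U *m ket i) (replicated N (SUmx U) i))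
  <= (d%:R + 1) / d%:R.
Proof.
move=> [Npsd [rho [_ trrho sumN]]].
have dn0 : d%:R != 0 :> C by rewrite pnatr_eq0 -lt0n ltnW.
have dp : 0 < d%:R :> C by rewrite ltr0n ltnW.
have d2p : 0 < d%:R ^+ 2 - 1 :> C by rewrite subr_gt0 exprn_egt1// ltr1n.
have d2n0 := lt0r_neq0 d2p.
have sp : 0 < s by rewrite mulr_gt0.
under eq_bigr do rewrite Cint_fidelity.
rewrite exchange_big/=.
have col j : \sum_i ((d%:R - (i == j)%:R) / s * tN i j +
    (d%:R * (i == j)%:R - 1) / s * oN i j) <= (d%:R + 1) / d%:R ^+ 2.
  have sumt : \sum_i tN i j = d%:R by exact: sum_network_trace sumN trrho j.
  have sumo : \sum_i oN i j = 1 by exact: sum_network_omega sumN trrho j.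
  have o_ge0 i : 0 <= oN i j.
    exact: (@psd_sum_entries _ _ _ _ (fun a => idx3 a j a)).
  have o_le1 : oN j j <= 1.
    by rewrite -sumo (bigD1 j)//= lerDl; apply: sumr_ge0.
  have o_let : oN j j <= d%:R * tN j j.
    have := @psd_sum_entries_le _ _ _ _ (fun a => idx3 a j a) (Npsd j).
    rewrite card_ord => /le_trans; apply; rewrite ler_pM2l//.
    apply: ler_sum => a _; rewrite (bigD1 a)//= lerDl; apply: sumr_ge0 => b _.
    exact: psd_diag.
  have -> : \sum_i ((d%:R - (i == j)%:R) / s * tN i j +
      (d%:R * (i == j)%:R - 1) / s * oN i j) =
      (d%:R * d%:R - tN j j + d%:R * oN j j - 1) / s.
    transitivity ((d%:R * \sum_i tN i j - \sum_i tN i j * (i == j)%:R +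
        d%:R * \sum_i oN i j * (i == j)%:R - \sum_i oN i j) / s); last first.
      by rewrite sumt sumo !sum_mul_delta.
    rewrite !mulr_sumr -sumrB -big_split/= -sumrB mulr_suml.
    apply: eq_bigr => i _; ring.
  have -> : (d%:R + 1) / d%:R ^+ 2 = ((d%:R ^+ 2 - 1) * (1 + d%:R^-1)) / s.
    by rewrite /s; field; apply/andP.
  rewrite ler_pM2r ?invr_gt0// -subr_ge0.
  (* The slack is a nonnegative combination of the two slacks [1 - o_jj] and [d t_jj - o_jj]. *)
  have -> : (d%:R ^+ 2 - 1) * (1 + d%:R^-1) -
      (d%:R * d%:R - tN j j + d%:R * oN j j - 1) =
      d%:R^-1 * ((d%:R ^+ 2 - 1) * (1 - oN j j) + (d%:R * tN j j - oN j j)).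
    by field.
  apply: mulr_ge0; first by rewrite invr_ge0 ler0n.
  apply: addr_ge0; last by rewrite subr_ge0.
  by apply: mulr_ge0; [exact: ltW|rewrite subr_ge0].
apply: (@le_trans _ _ (\sum_(j < d) (d%:R + 1) / d%:R ^+ 2)).
  by apply: ler_sum => j _; exact: col.
rewrite sumr_const card_ord le_eqVlt; apply/orP; left; apply/eqP.
by rewrite -[_ *+ d]mulr_natr; field.
Qed.

End HaarFidelity.

Theorem mainTheorem1 (R : realType) (d : nat) (hd : (1 < d)%N)
    (mu : probability (SU R d) R) (nu : probability (sphere R hd) R)
    (hmu : is_haar mu) (hnu : unitarily_invariant nu) :
  let Dopt : R := d%:R / (d%:R ^+ 2 - 1) * (1 - (d%:R + 1) / d%:R ^+ 2) ^+ 2 in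
  [/\ (forall N : 'I_d -> 'M[cplx R]_(d * d * d), learning_network N ->
         (Dopt%:E <= figure_of_merit mu nu N)%E),
      learning_network (@opt_network R d),
      figure_of_merit mu nu (@opt_network R d) = Dopt%:E,
      (forall (U : SU R d) (i : 'I_d),
         replicated opt_network (SUmx U) i =
           (d%:R * (d%:R - 1))^-1 *: (SUmx U *m ketbra (ket i) *m (SUmx U)^t*) +
           ((d%:R ^+ 2 - d%:R - 1) / (d%:R ^+ 2 * (d%:R - 1))) *: 1%:M) &
      (forall i : 'I_d,
         expect (ket i) (replicated opt_network 1%:M i) =
           (d%:R + 1) / d%:R ^+ 2 :> cplx R)].
Proof.
move=> Dopt; pose C := cplx R.
have dn0 : d%:R != 0 :> C by rewrite pnatr_eq0 -lt0n ltnW.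
have d1 : d%:R - 1 != 0 :> C by rewrite subr_eq0 pnatr_eq1 gtn_eqF.
have d1' : d%:R + 1 != 0 :> C by rewrite natr1 pnatr_eq0.
have d2 : d%:R ^+ 2 - 1 != 0 :> C by rewrite subr_sqr_1 mulf_neq0.
(* This is [1 - 1 / (d (d - 1))], the factor in [E_i - G_i = t (E_i - I / d)] for the optimal
   network. Its sign matters: the fidelity enters the lower bound with coefficient [- 2 c t]. *)
pose t : C := (d%:R ^+ 2 - d%:R - 1) / (d%:R * (d%:R - 1)).
have t_ge0 : 0 <= t.
  rewrite divr_ge0 ?mulr_ge0 ?subr_ge0 ?ler0n ?ler1n ?(ltnW hd)//.
  have -> : d%:R ^+ 2 - d%:R = (d * d.-1)%:R :> C.
    by rewrite natrM -subn1 natrB ?(ltnW hd)// mulrBr mulr1 expr2.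
  by rewrite ler1n muln_gt0 (ltnW hd) -subn1 subn_gt0.
have tr : t^* = t by exact: geC0_conj.
pose c : C := (d%:R * (d%:R + 1))^-1.
have c_ge0 : 0 <= c by rewrite invr_ge0 mulr_ge0 ?addr_ge0 ?ler0n.
(* The [d] outcomes contribute equally, each with the spherical average at
   [t *: centered_vn U i]. *)
have DoptE : real_complex R Dopt = d%:R * (c * (t ^+ 2 * (1 - d%:R^-1))) :> C.
  rewrite /Dopt rmorphM fmorph_div rmorphXn !rmorphB fmorph_div rmorphD !rmorphXn/=.
  rewrite !rmorph_nat !rmorph1 /c /t; field.
  by rewrite dn0 d1 d1' d2.
split.
- move=> N learnN; rewrite (figure_of_meritE mu hnu) lee_fin.
  pose g (U : SU R d) := \sum_i expect (SUmx U *m ket i) (replicated N (SUmx U) i).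
  have gB : bounded_measurable g.
    by apply: bounded_measurable_sum => i; exact: bounded_measurable_fidelity.
  pose a0 : C := c * (2 * t * d%:R - t ^+ 2 * (d%:R - 1)).
  have bgB : bounded_measurable (fun U => - (c * (2 * t)) * g U).
    by apply: bounded_measurableM => //; exact: bounded_measurable_cst.
  (* The pointwise tangent bound is affine in [g], so its Haar average depends only on the average
     fidelity. *)
  apply: (@le_trans _ _ (complex.Re (Cint mu (fun U => a0 + - (c * (2 * t)) * g U)))).
    rewrite CintD//; last exact: bounded_measurable_cst.
    rewrite Cint_cst CintZ//.
    have : real_complex R Dopt <= a0 + - (c * (2 * t)) * Cint mu g.
      have gle : Cint mu g <= (d%:R + 1) / d%:R.
        rewrite Cint_sum; last by move=> i; exact: bounded_measurable_fidelity.
        exact: Cint_fidelity_le.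
      (* At the largest fidelity [d - (d + 1) / d = t (d - 1)], so the affine bound equals
         [c t^2 (d - 1)], which is [Dopt]. *)
      apply: (@le_trans _ _ (a0 + - (c * (2 * t)) * ((d%:R + 1) / d%:R))).
        rewrite le_eqVlt; apply/orP; left; apply/eqP.
        rewrite DoptE /a0 /c /t; field.
        by rewrite dn0 d1 d1'.
      by rewrite lerD2l !mulNr lerN2 ler_wpM2l// mulr_ge0// mulr_ge0 ?ler0n.
    by rewrite lecE => /andP[].
  apply: le_Re_Cint => //; last 1 first.
  + move=> U.
    have := sum_sphere_avg_sq_ge (ltnW hd) learnN (SUmx_unitary U) tr.
    rewrite lecE => /andP[_]; congr (complex.Re _ <= _).
    by rewrite /a0 /g /c; ring.
  + by apply: bounded_measurableD => //; exact: bounded_measurable_cst.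
  + exact: bounded_measurable_merit.
- exact: opt_network_learning.
- rewrite (figure_of_meritE mu hnu); congr _%:E.
  transitivity (complex.Re (real_complex R Dopt)); last by [].
  (* For the optimal network the integrand does not depend on [U]. *)
  congr complex.Re; rewrite DoptE -[RHS](Cint_cst mu); congr Cint.
  apply/funext => U.
  transitivity (\sum_(i < d) c * (t ^+ 2 * (1 - d%:R^-1))); last first.
    by rewrite sumr_const card_ord mulr_natl.
  apply: eq_bigr => i _.
  rewrite -(sphere_avg_sq_centered (ltnW hd) i (SUmx_unitary U) tr); congr sphere_avg_sq.
  rewrite /povm_error /centered_vn replicated_opt ?SUmx_unitary//.
  rewrite -/(von_neumann (SUmx U) i) opprD addrA scalerBr scalerA.
  rewrite -[X in X - _ - _]scale1r -scalerBl; congr (_ *: _ - _ *: _).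
    by rewrite /t; field; rewrite dn0 d1.
  by rewrite /t; field; rewrite dn0 d1.
- by move=> U i; apply: replicated_opt => //; exact: SUmx_unitary.
- by move=> i; exact: replicated_opt_diag.
Qed.
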